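(* Let $d \ge 2$ be a fixed integer. Then every $n$-vertex $d$-regular graph $G$ satisfies $$\operatorname{tww}(G) \le n^{\frac{d-2}{2d-2}+o(1)},$$ and almost all $n$-vertex $d$-regular graphs attain this bound with equality, i.e. satisfy $\operatorname{tww}(G) = n^{\frac{d-2}{2d-2}+o(1)}$. Explicitly: (a) for every $\delta>0$ there is $n_0$ such that for all $n\ge n_0$ every $d$-regular graph $G$ on $n$ vertices satisfies $\operatorname{tww}(G)\le n^{\frac{d-2}{2d-2}+\delta}$; and (b) for every $\delta>0$, if $G$ is a uniformly random $d$-regular graph with vertex set $\{1,\dots,n\}$, then $\Pr\big[\operatorname{tww}(G)\ge n^{\frac{d-2}{2d-2}-\delta}\big]\to 1$ as $n\to\infty$ along integers $n$ with $dn$ even.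
   Context: All graphs are finite and simple. Twin-width: a trigraph is a finite vertex set together with two disjoint sets of edges (unordered pairs of distinct vertices), called black and red; a graph is regarded as a trigraph with all edges black. Contracting two distinct (not necessarily adjacent) vertices $u,v$ of a trigraph means replacing them by a new vertex $w$ where, for each other vertex $x$: $wx$ is a black edge if both $ux$ and $vx$ are black edges; $wx$ is a non-edge if neither $ux$ nor $vx$ is an edge (of either colour); and $wx$ is a red edge otherwise; all other edges are unchanged. The twin-width $\operatorname{tww}(G)$ is the minimum integer $w\ge 0$ such that there is a sequence of contractions from $G$ to a one-vertex trigraph in which, in every trigraph of the sequence, every vertex is incident with at most $w$ red edges. *)

(* Defs.v *)
From HB Require Import structures.
From mathcomp Require Import all_boot all_order all_algebra.
From mathcomp Require Import boolp reals.

Set Implicit Arguments.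
Unset Strict Implicit.
Unset Printing Implicit Defensive.

Import Order.TTheory GRing.Theory Num.Theory.

Local Open Scope nat_scope.

(* A finite simple graph whose vertex set is the whole finite type [T]; an edge
   is a two-element set of vertices. *)
Record sgraph (T : finType) := SGraph {
  edges : {set {set T}};
  edgesP : [forall e in edges, #|e| == 2] }.

HB.instance Definition _ (T : finType) := [isSub for @edges T].
HB.instance Definition _ (T : finType) := [Finite of sgraph T by <:].

Definition degree (T : finType) (G : sgraph T) (v : T) : nat :=
  #|[set e in edges G | v \in e]|.

Definition regular (T : finType) (d : nat) (G : sgraph T) : bool :=
  [forall v : T, degree G v == d].

(* The vertex set of a trigraph is a subset of a fixed ambient type, so that all
   trigraphs of a contraction sequence live over the same type. *)
Record trigraph (T : finType) := Trigraph {
  vertices : {set T};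
  black : {set {set T}};
  red : {set {set T}};
  blackP : [forall e in black, (e \subset vertices) && (#|e| == 2)];
  redP : [forall e in red, (e \subset vertices) && (#|e| == 2)];
  black_red_disjoint : [disjoint black & red] }.

Lemma black_sgraphP (T : finType) (G : sgraph T) :
  [forall e in edges G, (e \subset [set: T]) && (#|e| == 2)].
Proof.
by apply/forall_inP => e eG; rewrite subsetT (forall_inP (edgesP G)).
Qed.

Lemma red_sgraphP (T : finType) :
  [forall e in @set0 {set T}, (e \subset [set: T]) && (#|e| == 2)].
Proof. by apply/forall_inP => e; rewrite inE. Qed.

Lemma disjoint_sgraph (T : finType) (G : sgraph T) :
  [disjoint edges G & @set0 {set T}].
Proof. by rewrite -setI_eq0 setI0. Qed.

Definition trigraph_of (T : finType) (G : sgraph T) : trigraph T :=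
  Trigraph (black_sgraphP G) (red_sgraphP T) (disjoint_sgraph G).

Definition edge (T : finType) (H : trigraph T) (x y : T) : bool :=
  ([set x; y] \in black H) || ([set x; y] \in red H).

(* [H'] is obtained from [H] by contracting [u] and [v] into [w].  As [u] and
   [v] disappear, their names may be reused for [w]; the ambient type is finite,
   so a name outside [vertices H] need not exist. *)
Definition contracts (T : finType) (H H' : trigraph T) (u v w : T) : Prop :=
  let rest := vertices H :\: [set u; v] in
  [/\ [/\ u \in vertices H, v \in vertices H & u != v],
      w \notin rest /\ vertices H' = w |: rest,
      forall x, x \in rest ->
        ([set w; x] \in black H') =
        ([set u; x] \in black H) && ([set v; x] \in black H),
      forall x, x \in rest ->
        ([set w; x] \in red H') =
        (edge H u x || edge H v x) &&
        ~~ (([set u; x] \in black H) && ([set v; x] \in black H))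
    & forall x y, x \in rest -> y \in rest ->
        ([set x; y] \in black H') = ([set x; y] \in black H) /\
        ([set x; y] \in red H') = ([set x; y] \in red H)].

Definition contraction (T : finType) (H H' : trigraph T) : Prop :=
  exists u v w : T, contracts H H' u v w.

Definition red_degree (T : finType) (H : trigraph T) (x : T) : nat :=
  #|[set e in red H | x \in e]|.

Definition has_contraction_sequence (T : finType) (G : sgraph T) (w : nat) :
    Prop :=
  exists (k : nat) (H : nat -> trigraph T),
    [/\ H 0 = trigraph_of G,
        #|vertices (H k)| = 1,
        forall i, i < k -> contraction (H i) (H i.+1)
      & forall i x, i <= k -> x \in vertices (H i) -> red_degree (H i) x <= w].

Section Existence.
Variable T : finType.
Implicit Types H : trigraph T.

Lemma exists_contraction H (u v : T) :
  u \in vertices H -> v \in vertices H -> u != v ->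
  exists H', contracts H H' u v u.
Proof.
move=> uH vH uv.
pose rest := vertices H :\: [set u; v].
have uNrest : u \notin rest by rewrite !inE eqxx.
have rest_neq x : x \in rest -> u != x.
  by move=> xr; apply: contraNneq uNrest => ->.
pose bb x := ([set u; x] \in black H) && ([set v; x] \in black H).
pose ee x := (edge H u x || edge H v x) && ~~ bb x.
pose mk (E : {set {set T}}) (p : pred T) : {set {set T}} :=
  [set e in E | e \subset rest] :|: [set [set u; x] | x in rest & p x].
have in_mk_u E p x : x \in rest -> ([set u; x] \in mk E p) = p x.
  move=> xr; rewrite !inE subUset !sub1set (negPf uNrest) /= andbF /=.
  apply/imsetP/idP => [[y]|px]; last by exists x; rewrite // inE xr.
  rewrite inE => /andP[yr py] /setP/(_ x).
  rewrite !inE eqxx orbT => /esym/orP[/eqP xu|/eqP -> //].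
  by rewrite -xu xr in uNrest.
have in_mk_rest E p x y : x \in rest -> y \in rest ->
    ([set x; y] \in mk E p) = ([set x; y] \in E).
  move=> xr yr; rewrite !inE subUset !sub1set xr yr !andbT.
  case: imsetP => [[z _] /setP/(_ u)|_]; last by rewrite orbF.
  by rewrite !inE eqxx (negPf (rest_neq _ xr)) (negPf (rest_neq _ yr)).
have mk_valid (E : {set {set T}}) (p : pred T) :
    [forall e in E, (e \subset vertices H) && (#|e| == 2)] ->
    [forall e in mk E p, (e \subset u |: rest) && (#|e| == 2)].
  move=> /forall_inP hE; apply/forall_inP => e.
  rewrite !inE => /orP[/andP[/hE/andP[_ ->] er]|/imsetP[x]].
    by rewrite andbT (subset_trans er) // subsetUr.
  rewrite inE => /andP[xr _] ->; rewrite cards2 (rest_neq _ xr) andbT.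
  by rewrite setUS // sub1set.
have mk_disj : [disjoint mk (black H) bb & mk (red H) ee].
  rewrite -setI_eq0; apply/eqP/setP => e; rewrite inE in_set0.
  apply/negP => /andP[]; rewrite {1}/mk !inE => /orP[].
    move=> /andP[eb er] /orP[/andP[ered _]|].
      by have := disjointFr (black_red_disjoint H) eb; rewrite ered.
    case/imsetP => x _ eE; have : u \in rest.
      by apply: (subsetP er); rewrite eE !inE eqxx.
    by rewrite (negPf uNrest).
  case/imsetP => x; rewrite inE => /andP[xr bx] -> eM.
  by have := in_mk_u (red H) ee x xr; rewrite /ee bx andbF !inE eM.
exists (Trigraph (mk_valid _ bb (blackP H)) (mk_valid _ ee (redP H)) mk_disj).
by split=> //= [x xr|x xr|x y xr yr]; rewrite ?in_mk_u ?in_mk_rest.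
Qed.

Lemma has_contraction_sequence_ex (G : sgraph T) :
  0 < #|T| -> exists w, has_contraction_sequence G w.
Proof.
move=> T0; exists #|{set T}|.
suff [k [H [H0 H1 HS]]] : exists (k : nat) (H : nat -> trigraph T),
    [/\ H 0 = trigraph_of G, #|vertices (H k)| = 1 &
      forall i, i < k -> contraction (H i) (H i.+1)].
  by exists k, H; split=> // i x _ _; exact: max_card.
have : 0 < #|vertices (trigraph_of G)| by rewrite cardsT.
move: (trigraph_of G) => H; move m: (#|_|) => n.
elim: n H m => // -[|n] IH H HE _.
  by exists 0, (fun=> H).
have /card_gt1P[u [v [uH vH uv]]] : 1 < #|vertices H| by rewrite HE.
have [H' HH'] := exists_contraction uH vH uv.
have [_ [uN VE] _ _ _] := HH'.
have cardH' : #|vertices H'| = n.+1.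
  rewrite VE cardsU1 uN cardsD (setIidPr _) ?cards2 ?uv ?HE ?subSS ?subn0 //.
  by rewrite subUset !sub1set uH vH.
have [k [f [f0 f1 fS]]] := IH _ cardH' isT.
exists k.+1, (fun i => if i is j.+1 then f j else H); split=> // -[_|i /fS //].
by rewrite f0; exists u, v, u.
Qed.

End Existence.

(* The value 0 in the second branch is only reached by the graph without
   vertices, see [has_contraction_sequence_ex]. *)
Definition tww (T : finType) (G : sgraph T) : nat :=
  if pselect (exists w, `[< has_contraction_sequence G w >]) is left exw
  then ex_minn exw else 0.

(* The probability that a uniformly random element of [S] lies in [A]. *)
Definition uniform_pr (R : realType) (T : finType) (S A : {set T}) : R :=
  (#|S :&: A|%:R / #|S|%:R)%R.

(* Main.v *)
Require Import Defs.
From mathcomp Require Import all_boot all_order all_algebra all_fingroup.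
From mathcomp Require Import boolp zify.

(* Upper bound. Give every vertex [x] a random string [s_x] and label [v] by
   prefixes of the strings of the vertices near [v]: every non-backtracking walk
   of length [j <= k] from [v] to [x] contributes [(d-1)^(k-j)] characters of
   [s_x]. Every label then has [M] characters, whereas the label of a neighbour
   of [v] has at most [W] characters that the label of [v] does not show, with
   [M + W = 2 (k+1) (d-1)^k] and [W / (M+W) -> (d-2) / (2d-2)] as [k] grows.
   Over an alphabet of size about [n^(1/(M+W))] there are about [n / n^(W/(M+W))]
   labels, so that some choice of the strings makes all fibres of the labelling,
   as well as all degrees of its quotient, of order [n^(W/(M+W))]. Contracting
   first the fibres and then shrinking the alphabet letter by letter keeps all
   red degrees of that order.

   Lower bound. Order the vertices so that every part occurring in a contraction
   sequence of width [w] is an interval, and cut the order into chunks of about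
   [S = n^((d-2)/(2d-2))] vertices. When a chunk is first contained in a single
   part, this part has at most [w] neighbouring parts (all red, as [S > d]), and
   each of them meets at most two chunks that are not yet contained in a part. So
   the quotient of the graph by the chunks has only [O(w n / S)] edges, and there
   are too few graphs with such a quotient, compared with the [n^(dn/2 - o(n))]
   regular graphs obtained as lifts of [K_{d,d}]. For [d = 2] this count is not
   strong enough, but a 2-regular graph of twin-width 0 only has components with
   at most four vertices. *)

Set Implicit Arguments.
Unset Strict Implicit.
Unset Printing Implicit Defensive.

Import Order.TTheory GRing.Theory Num.Theory.

Local Open Scope nat_scope.

(** * Quotient trigraphs *)

Lemma set2_inj (T : finType) (x y x' y' : T) :
  [set x; y] = [set x'; y'] -> (x = x' /\ y = y') \/ (x = y' /\ y = x').
Proof.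
move=> E.
have : x \in [set x'; y'] by rewrite -E !inE eqxx.
have : y \in [set x'; y'] by rewrite -E !inE eqxx orbT.
have : x' \in [set x; y] by rewrite E !inE eqxx.
have : y' \in [set x; y] by rewrite E !inE eqxx orbT.
rewrite !inE => A B C D.
case/orP: A => /eqP A; case/orP: B => /eqP B; case/orP: C => /eqP C; case/orP: D => /eqP D;
  by [left; split; congruence|right; split; congruence].

Qed.

Lemma card_star (T : finType) (E : {set {set T}}) (v : T) :
  [forall e in E, #|e| == 2] ->
  #|[set e in E | v \in e]| = #|[set u | [set v; u] \in E]|.
Proof.
move=> /forall_inP E2.
have vNu u : [set v; u] \in E -> v != u.
  by move/E2; rewrite cards2; case: (v == u).
rewrite -(card_in_imset (f := fun u => [set v; u])); last first.
  move=> u u'; rewrite !inE => uE u'E /set2_inj[[_ //]|[vu' uv]].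
  by have := vNu _ uE; rewrite uv eqxx.
apply: eq_card => e; rewrite inE; apply/andP/imsetP => [[eE ve]|[u]].
  have /cards2P[x [y [xy eq_e]]] := E2 _ eE.
  move: ve; rewrite eq_e !inE => /orP[]/eqP vE.
    by exists y; rewrite ?inE vE -?eq_e.
  by exists x; rewrite ?inE vE setUC -?eq_e.
by rewrite inE => uE ->; rewrite uE !inE eqxx.
Qed.

Section Adjacency.
Variables (T : finType) (G : sgraph T).

Definition adj : rel T := fun a b => [set a; b] \in edges G.
Definition nbr (v : T) : {set T} := [set u | adj v u].

Lemma adj_sym : symmetric adj.
Proof. by move=> a b; rewrite /adj setUC. Qed.

Lemma adj_irr a : adj a a = false.
Proof.
apply/negP => /(forall_inP (edgesP G)).
by rewrite setUid cards1.
Qed.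

Lemma degreeE v : degree G v = #|nbr v|.
Proof. by rewrite /degree card_star ?(edgesP G). Qed.

End Adjacency.

Lemma red_degreeE (T : finType) (H : trigraph T) (x : T) :
  red_degree H x = #|[set y | [set x; y] \in red H]|.
Proof.
rewrite /red_degree card_star //; apply/forall_inP => e eH.
by have /andP[] := forall_inP (redP H) _ eH.
Qed.

Lemma trigraph_eq (T : finType) (H1 H2 : trigraph T) :
  vertices H1 = vertices H2 -> black H1 = black H2 -> red H1 = red H2 ->
  H1 = H2.
Proof.
case: H1 H2 => [V1 B1 R1 p1 q1 r1] [V2 B2 R2 p2 q2 r2] /= EV EB ER.
subst V2 B2 R2; congr Trigraph; exact: bool_irrelevance.
Qed.

(** The clauses of [contracts] fix the colour of every pair inside the new vertex set, and edges are
    two-element subsets of it. Hence contraction, though given as a relation, is a function of [u],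
    [v] and [w]. *)
Lemma contracts_uniq (T : finType) (H H1 H2 : trigraph T) u v w :
  contracts H H1 u v w -> contracts H H2 u v w -> H1 = H2.
Proof.
move=> [_ [wN V1] b1 r1 e1] [_ [_ V2] b2 r2 e2].
have agree (E1 E2 : {set {set T}}) :
    [forall e in E1, (e \subset vertices H1) && (#|e| == 2)] ->
    [forall e in E2, (e \subset vertices H1) && (#|e| == 2)] ->
    (forall x, x \in vertices H :\: [set u; v] ->
      ([set w; x] \in E1) = ([set w; x] \in E2)) ->
    (forall x y, x \in vertices H :\: [set u; v] ->
      y \in vertices H :\: [set u; v] ->
      ([set x; y] \in E1) = ([set x; y] \in E2)) -> E1 = E2.
  move=> /forall_inP p1 /forall_inP p2 wE rE; apply/setP => e.
  have [|eN] := boolP ((e \subset vertices H1) && (#|e| == 2)); last first.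
    by apply/idP/idP => [/p1|/p2]; rewrite (negPf eN).
  case/andP => sub /cards2P[x [y [xy eE]]].
  move: sub; rewrite eE subUset !sub1set V1 => /andP[].
  case/setU1P => [xw|xr]; case/setU1P => [yw|yr].
  - by rewrite xw yw eqxx in xy.
  - by rewrite xw wE.
  - by rewrite yw setUC wE.
  - exact: rE.
have V12 : vertices H1 = vertices H2 by rewrite V1 V2.
apply: trigraph_eq => //.
  apply: agree; rewrite ?V12; try exact: blackP.
  - by rewrite -V12; exact: blackP.
  - by move=> x xr; rewrite b1 ?b2.
  - by move=> x y xr yr; have [-> _] := e1 _ _ xr yr; have [-> _] := e2 _ _ xr yr.
apply: agree; rewrite ?V12; try exact: redP.
- by rewrite -V12; exact: redP.
- by move=> x xr; rewrite r1 ?r2.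
- by move=> x y xr yr; have [_ ->] := e1 _ _ xr yr; have [_ ->] := e2 _ _ xr yr.
Qed.

Section Quotient.
Variables (T : finType) (G : sgraph T).
Implicit Types (f : T -> T) (x y u v w : T).

Definition parts f : {set T} := [set f a | a : T].

(** Vacuously true when [x] or [y] is not a value of [f]; this is why [pairset] also asks for
    membership in [parts f]. *)
Definition full f x y :=
  [forall a, forall b, (f a == x) && (f b == y) ==> adj G a b].

Definition touch f x y := [exists a, exists b, [&& f a == x, f b == y & adj G a b]].

Definition pairset f (p : rel T) : {set {set T}} :=
  [set [set q.1; q.2] | q in [set q : T * T |
    [&& q.1 != q.2, q.1 \in parts f, q.2 \in parts f & p q.1 q.2]]].

Lemma fullP f x y :
  reflect (forall a b, f a = x -> f b = y -> adj G a b) (full f x y).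
Proof.
apply: (iffP forallP) => [H a b /eqP ax /eqP by_|H a].
  by have /forallP/(_ b) := H a; rewrite ax by_.
by apply/forallP => b; apply/implyP => /andP[/eqP ? /eqP ?]; apply: H.
Qed.

Lemma touchP f x y :
  reflect (exists a b, [/\ f a = x, f b = y & adj G a b]) (touch f x y).
Proof.
apply: (iffP existsP) => [[a /existsP[b /and3P[/eqP ? /eqP ? ?]]]|[a [b [? ? ?]]]].
  by exists a, b.
by exists a; apply/existsP; exists b; apply/and3P; split => //; apply/eqP.
Qed.

Lemma full_sym f : symmetric (full f).
Proof.
by move=> x y; apply/fullP/fullP => H a b ? ?; rewrite adj_sym; apply: H.
Qed.

Lemma touch_sym f : symmetric (touch f).
Proof.
by move=> x y; apply/touchP/touchP => -[a [b [? ? ?]]]; exists b, a; rewrite adj_sym.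
Qed.

Lemma mem_pairset f p x y : symmetric p ->
  ([set x; y] \in pairset f p) =
  [&& x != y, x \in parts f, y \in parts f & p x y].
Proof.
move=> psym; apply/imsetP/idP => [[[x' y']]|H]; last first.
  by exists (x, y); rewrite ?inE.
rewrite inE /= => H /set2_inj[[-> ->] //|[-> ->]].
by case/and4P: H => H1 H2 H3 H4; rewrite eq_sym H1 H2 H3 psym.
Qed.

Lemma pairset_valid f p :
  [forall e in pairset f p, (e \subset parts f) && (#|e| == 2)].
Proof.
apply/forall_inP => e /imsetP[[x y]]; rewrite inE /= => /and4P[xy xf yf _] ->.
by rewrite subUset !sub1set xf yf cards2 xy.
Qed.

Definition partial f : rel T := fun x y => touch f x y && ~~ full f x y.

Lemma partial_sym f : symmetric (partial f).
Proof. by move=> x y; rewrite /partial touch_sym full_sym. Qed.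

Lemma pairset_disjoint f : [disjoint pairset f (full f) & pairset f (partial f)].
Proof.
rewrite disjoint_subset; apply/subsetP => e /imsetP[[x y]].
rewrite !inE /= => /and4P[_ _ _ Fxy] ->.
by rewrite mem_pairset; [rewrite /partial Fxy !andbF|exact: partial_sym].
Qed.

(* The trigraph whose vertices are the fibres of [f], named by their values. *)
Definition quot f : trigraph T :=
  Trigraph (pairset_valid f (full f)) (pairset_valid f (partial f))
    (pairset_disjoint f).

Lemma quot_black f x y : ([set x; y] \in black (quot f)) =
  [&& x != y, x \in parts f, y \in parts f & full f x y].
Proof. exact: (mem_pairset _ _ _ (full_sym f)). Qed.

Lemma quot_red f x y : ([set x; y] \in red (quot f)) =
  [&& x != y, x \in parts f, y \in parts f & partial f x y].
Proof. exact: (mem_pairset _ _ _ (@partial_sym f)). Qed.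

Lemma partsP f x : reflect (exists a, f a = x) (x \in parts f).
Proof. by apply: (iffP imsetP) => [[a _ ->]|[a <-]]; exists a. Qed.

Lemma full_touch f x y : x \in parts f -> y \in parts f ->
  full f x y -> touch f x y.
Proof.
by move=> /partsP[a ax] /partsP[b by_] /fullP H; apply/touchP; exists a, b; split=> //; apply: H.
Qed.

Lemma touch_parts f x y : touch f x y -> x \in parts f /\ y \in parts f.
Proof. by move=> /touchP[a [b [<- <- _]]]; split; apply/partsP; [exists a|exists b]. Qed.

Lemma quot_edge f x y : edge (quot f) x y = (x != y) && touch f x y.
Proof.
rewrite /edge quot_black quot_red.
have [->|xy] //= := eqVneq x y.
have [xf|xf] := boolP (x \in parts f); last first.
  by apply/esym; apply: contraNF xf => H; case: (touch_parts H).
have [yf|yf] := boolP (y \in parts f); last first.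
  by apply/esym; apply: contraNF yf => H; case: (touch_parts H).
rewrite /partial /=; have [F|_] := boolP (full f x y); last by rewrite andbT.
by rewrite full_touch.
Qed.

Lemma red_degree_quot f x :
  red_degree (quot f) x = #|[set y | [&& y != x, touch f x y & ~~ full f x y]]|.
Proof.
rewrite red_degreeE; apply: eq_card => y; rewrite inE quot_red inE /partial eq_sym.
have [H|_] := boolP (touch f x y); last by rewrite /= !andbF.
by case: (touch_parts H) => -> ->.
Qed.

Lemma quot_id : quot id = trigraph_of G.
Proof.
have pT : parts id = [set: T] by apply/setP => x; rewrite inE; apply/partsP; exists x.
have fullE x y : full id x y = adj G x y.
  by apply/fullP/idP => [->//|H a b -> ->].
have touchE x y : touch id x y = adj G x y.
  by apply/touchP/idP => [[a [b [<- <-]]]//|H]; exists x, y.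
apply: trigraph_eq => //=; apply/setP => e; last first.
  rewrite inE; apply/negP => /imsetP[[x y]]; rewrite inE /= /partial fullE touchE.
  by rewrite andbN !andbF.
apply/imsetP/idP => [[[x y]]|eG].
  by rewrite inE /= fullE => /and4P[_ _ _ H] ->.
have /cards2P[x [y [xy eE]]] := forall_inP (edgesP G) _ eG.
by exists (x, y) => //; rewrite inE /= fullE pT !inE xy /adj -eE.
Qed.

Definition merge_parts f u v w : T -> T :=
  fun a => if (f a == u) || (f a == v) then w else f a.

Lemma contracts_quot f u v w :
  u \in parts f -> v \in parts f -> u != v ->
  w \notin parts f :\: [set u; v] ->
  contracts (quot f) (quot (merge_parts f u v w)) u v w.
Proof.
move=> uf vf uv wN; set rest := _ :\: _ in wN *; set g := merge_parts _ _ _ _.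
have restP x : x \in rest -> [/\ x \in parts f, x != u, x != v & x != w].
  move=> xr; have xw : x != w by apply: contraNneq wN => <-.
  by move: xr; rewrite !inE negb_or => /andP[/andP[-> ->] ->].
have gw a : (g a == w) = (f a == u) || (f a == v).
  rewrite /g /merge_parts; case: ifP => [_|/negbT N]; first by rewrite eqxx.
  apply/negP => /eqP E; case/negP: wN; rewrite /rest !inE -E N.
  by apply/partsP; exists a.
have gr x a : x \in rest -> (g a == x) = (f a == x).
  move/restP => [_ xu xv xw]; rewrite /g /merge_parts.
  case: ifP => // /orP[]/eqP ->; by rewrite ![_ == x]eq_sym (negPf xw) ?(negPf xu) ?(negPf xv).
have gparts : parts g = w |: rest.
  apply/setP => x; rewrite in_setU1; apply/partsP/orP => [[a <-]|[/eqP ->|xr]].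
  - have [|N] := boolP (g a == w); first by left.
    right; move: N; rewrite gw /g /merge_parts => N; rewrite (negPf N) !inE N.
    by apply/partsP; exists a.
  - by have /partsP[a /eqP au] := uf; exists a; apply/eqP; rewrite gw au.
  - have [/partsP[a /eqP ax] _ _ _] := restP _ xr.
    by exists a; apply/eqP; rewrite gr.
have wg : w \in parts g by rewrite gparts setU11.
have rg x : x \in rest -> x \in parts g by move=> xr; rewrite gparts setU1r.
have fullw x : x \in rest -> full g w x = full f u x && full f v x.
  move=> xr; apply/fullP/andP => [H|[/fullP H1 /fullP H2] a b /eqP].
    split; apply/fullP => a b /eqP au /eqP bx; apply: H; apply/eqP;
      by rewrite ?gw ?gr // au ?orbT.
  rewrite gw => H /eqP; rewrite gr // => /eqP bx.
  by case/orP: H => /eqP ?; [apply: H1|apply: H2].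
have touchw x : x \in rest -> touch g w x = touch f u x || touch f v x.
  move=> xr; apply/touchP/orP => [[a [b [/eqP]]]|].
    rewrite gw => H /eqP; rewrite gr // => /eqP bx ab.
    by case/orP: H => /eqP au; [left|right]; apply/touchP; exists a, b.
  case=> /touchP[a [b [/eqP au /eqP bx ab]]]; exists a, b; split=> //; apply/eqP;
    by rewrite ?gw ?gr // au ?orbT.
have fullr x y : x \in rest -> y \in rest -> full g x y = full f x y.
  move=> xr yr; apply/fullP/fullP => H a b /eqP ax /eqP by_; apply: H; apply/eqP;
  by rewrite ?gr // -?(gr x) // -?(gr y).
have touchr x y : x \in rest -> y \in rest -> touch g x y = touch f x y.
  move=> xr yr; apply/touchP/touchP => -[a [b [/eqP ax /eqP by_ ab]]];
    exists a, b; split=> //; apply/eqP; by rewrite ?gr // -?(gr x) // -?(gr y).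
split=> [|//|x xr|x xr|x y xr yr] //.
- have [xf xu xv xw] := restP _ xr.
  rewrite !quot_black wg rg // fullw // uf vf xf.
  by rewrite [w == x]eq_sym [u == x]eq_sym [v == x]eq_sym xu xv xw.
- have [xf xu xv xw] := restP _ xr.
  rewrite !quot_red !quot_black !quot_edge /partial wg rg // fullw // touchw // uf vf xf.
  by rewrite [w == x]eq_sym [u == x]eq_sym [v == x]eq_sym xu xv xw.
- have [xf _ _ _] := restP _ xr; have [yf _ _ _] := restP _ yr.
  by rewrite !quot_black !quot_red /partial !rg // xf yf fullr // touchr.
Qed.

(** The converse direction, for the lower bound: an arbitrary contraction sequence starting from a
    graph never leaves the quotients. *)
Lemma contracts_quotE f (H : trigraph T) u v w :
  contracts (quot f) H u v w -> H = quot (merge_parts f u v w).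
Proof.
move=> C; apply: contracts_uniq (C) _; case: C => -[uf vf uv] [wN _] _ _ _.
exact: contracts_quot.
Qed.

End Quotient.

Arguments adj_irr {T} G a.

Lemma tww_le (T : finType) (G : sgraph T) w :
  has_contraction_sequence G w -> tww G <= w.
Proof.
move=> Hw; rewrite /tww; case: pselect => [ex|[]]; last by exists w; apply/asboolP.
by case: ex_minnP => m _; apply; apply/asboolP.
Qed.

Lemma tww_has (T : finType) (G : sgraph T) :
  0 < #|T| -> has_contraction_sequence G (tww G).
Proof.
move=> T0; rewrite /tww; case: pselect => [ex|[]].
  by case: ex_minnP => m /asboolP.
by have [w Hw] := has_contraction_sequence_ex G T0; exists w; apply/asboolP.
Qed.

(** * Contraction sequences from chains of vertex labellings *)

Lemma leq_card_bigcup (I T : finType) (P : pred I) (F : I -> {set T}) :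
  #|\bigcup_(i | P i) F i| <= \sum_(i | P i) #|F i|.
Proof.
elim/big_rec2: _ => [|i m U _ IH]; first by rewrite cards0.
by rewrite (leq_trans (leq_card_setU _ _)) // leq_add2l.
Qed.

Lemma leq_card_bigcup_const (I T : finType) (A : {set I}) (F : I -> {set T}) D :
  (forall i, i \in A -> #|F i| <= D) -> #|\bigcup_(i in A) F i| <= #|A| * D.
Proof.
move=> FD; apply: leq_trans (leq_card_bigcup _ _) _.
by rewrite -sum_nat_const leq_sum.
Qed.

Definition refines (T A B : Type) (f : T -> A) (c : T -> B) :=
  forall a b, f a = f b -> c a = c b.

Section Sequences.
Variables (T : finType) (G : sgraph T) (w : nat).

Definition sequence_from (H : trigraph T) : Prop :=
  exists (k : nat) (Hs : nat -> trigraph T),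
    [/\ Hs 0 = H, #|vertices (Hs k)| = 1,
        forall i, i < k -> contraction (Hs i) (Hs i.+1)
      & forall i x, i <= k -> x \in vertices (Hs i) -> red_degree (Hs i) x <= w].

Lemma sequence_from_cons H H' : contraction H H' ->
  (forall x, x \in vertices H -> red_degree H x <= w) ->
  sequence_from H' -> sequence_from H.
Proof.
move=> HH' Hw [k [Hs [H0 H1 HS Hd]]].
exists k.+1, (fun i => if i is j.+1 then Hs j else H); split=> //.
  by case=> [_|i /HS //]; rewrite H0.
by case=> [x _ /Hw //|i x /Hd]; apply.
Qed.

Variables (L L' : eqType) (c : T -> L) (c' : T -> L').

(** Induction on the number of parts: as long as [f] is strictly finer than [c'], two parts with the
    same value of [c'] are merged. All maps on the way lie between [c] and [c'], so [Hw] bounds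
    their red degrees. *)
Lemma sequence_from_merge :
  (forall f x, refines c f -> refines f c' -> red_degree (quot G f) x <= w) ->
  (forall f, refines f c' -> refines c' f -> sequence_from (quot G f)) ->
  forall f, refines c f -> refines f c' -> sequence_from (quot G f).
Proof.
move=> Hw Hend f; have [m] := ubnP #|parts f|.
elim: m f => // m IH f; rewrite ltnS => fm cf fc'.
have [/forallP H|] := boolP [forall a, forall b, (c' a == c' b) ==> (f a == f b)].
  apply: Hend => // a b ab; apply/eqP.
  by have /forallP/(_ b)/implyP := H a; apply; apply/eqP.
case/forallPn => a /forallPn[b]; rewrite negb_imply => /andP[/eqP cab fab].
have fa : f a \in parts f by apply/partsP; exists a.
have fb : f b \in parts f by apply/partsP; exists b.
set g := merge_parts f (f a) (f b) (f a).
have fg : refines f g by move=> x y; rewrite /g /merge_parts => ->.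
have gc' : refines g c'.
  move=> x y; rewrite /g /merge_parts.
  have E z : (f z == f a) || (f z == f b) -> c' z = c' a.
    by case/orP => /eqP /fc' ->.
  case: ifP => [/E xa|xN]; case: ifP => [/E ya|yN].
  - by rewrite xa ya.
  - by move=> xy; move: yN; rewrite -xy eqxx.
  - by move=> xy; move: xN; rewrite xy eqxx.
  - exact: fc'.
have cg : refines c g by move=> x y /cf /fg.
apply: (@sequence_from_cons _ (quot G g)).
- exists (f a), (f b), (f a); apply: contracts_quot => //.
  by rewrite !inE eqxx.
- by move=> x _; apply: Hw.
- apply: IH => //; apply: leq_trans fm; apply: proper_card.
  apply/properP; split.
    apply/subsetP => y /partsP[x <-]; rewrite /g /merge_parts; case: ifP => // _.
    by apply/partsP; exists x.
  exists (f b) => //; apply/partsP => -[x]; rewrite /g /merge_parts.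
  case: ifP => [_ E|/negbT]; first by rewrite E eqxx in fab.
  by rewrite negb_or => /andP[_ N] E; rewrite E eqxx in N.
Qed.

End Sequences.

Section Between.
Variables (T : finType) (G : sgraph T) (L L' : finType) (c : T -> L) (c' : T -> L').

Definition label_nbrs (lam : L) : {set L} :=
  [set c b | b in [set b | [exists a, (c a == lam) && adj G a b]]].

(** A part lies in one fibre of [c'] and so carries at most [K] labels of [c], each with at most [D]
    neighbouring labels. Every part touching it contains the whole fibre of one of these
    neighbouring labels. *)
Lemma red_degree_between (K D : nat) (f : T -> T) (x : T) :
  refines c f -> refines f c' ->
  (forall a, #|[set c b | b in [set b | c' b == c' a]]| <= K) ->
  (forall a, #|label_nbrs (c a)| <= D) ->
  red_degree (quot G f) x <= K * D.
Proof.
move=> cf fc' HK HD; rewrite red_degree_quot.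
have [xf|xf] := boolP (x \in parts f); last first.
  rewrite (_ : [set y | _] = set0) ?cards0 //; apply/setP => y; rewrite !inE.
  apply/negP => /and3P[_ H _]; case: (touch_parts H) => H' _.
  by rewrite H' in xf.
have /partsP[a0 a0x] := xf.
pose C := [set c a | a in [set a | f a == x]].
pose B := \bigcup_(lam in C) label_nbrs lam.
have CB : #|B| <= K * D.
  apply: leq_trans (leq_card_bigcup_const (D := D) _) _.
    by move=> lam /imsetP[a _ ->].
  rewrite leq_mul2r; apply/orP; right; apply: leq_trans (HK a0).
  apply: subset_leq_card; apply: imsetS; apply/subsetP => a; rewrite !inE.
  by move=> /eqP ax; apply/eqP/fc'; rewrite ax a0x.
apply: leq_trans CB.
(* The part containing the fibre of [lam]. As [c] refines [f], the vertex picked does not matter;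
   the default [x] only serves labels that do not occur. *)
pose g lam := if [pick b | c b == lam] is Some b then f b else x.
apply: leq_trans (leq_imset_card g _).
apply: subset_leq_card; apply/subsetP => y; rewrite inE => /and3P[_ /touchP[a [b [ax by_ ab]]] _].
apply/imsetP; exists (c b).
  apply/bigcupP; exists (c a); first by apply/imsetP; exists a; rewrite ?inE ?ax.
  by apply/imsetP; exists b; rewrite // inE; apply/existsP; exists a; rewrite eqxx.
rewrite /g; case: pickP => [b' /eqP /cf -> //|/(_ b)]; by rewrite eqxx.
Qed.

End Between.

Section Descent.
Variables (T : finType) (G : sgraph T) (L : finType) (lab : nat -> T -> L).
Variables (K D N t d : nat).
Hypothesis T0 : 0 < #|T|.
Hypothesis lab_refines : forall r, refines (lab r.+1) (lab r).
Hypothesis lab_split : forall r a, r < N ->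
  #|[set lab r.+1 b | b in [set b | lab r b == lab r a]]| <= K.
Hypothesis lab_nbrs : forall r a, r <= N -> #|label_nbrs G (lab r) (lab r a)| <= D.
Hypothesis lab_0 : #|[set lab 0 b | b : T]| <= K.

(** The chain is descended from [lab r] to [lab 0], and from there to the constant map, whose only
    fibre carries at most [K] labels by [lab_0]. *)
Lemma sequence_from_labels r f : r <= N ->
  refines (lab r) f -> refines f (lab r) -> sequence_from (K * D) (quot G f).
Proof.
elim: r f => [|r IH] f rN lf fl.
  apply: (@sequence_from_merge _ G _ _ _ (lab 0) (fun=> tt)) => //.
    move=> g x lg gc; apply: (red_degree_between (c := lab 0) (c' := fun=> tt)) => //.
      move=> a; apply: leq_trans lab_0; apply: subset_leq_card; apply: imsetS.
      by apply/subsetP.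
    by move=> a; apply: lab_nbrs.
  move=> g _ gc; have [a0 _] := card_gt0P T0.
  have Vg : vertices (quot G g) = [set g a0].
    by apply/setP => x; rewrite inE; apply/partsP/eqP => [[a <-]|->]; [apply: gc|exists a0].
  exists 0, (fun=> quot G g); split=> //; first by rewrite Vg cards1.
  move=> _ x _ _; rewrite red_degree_quot.
  rewrite (_ : [set y | _] = set0) ?cards0 //; apply/setP => y; rewrite !inE.
  apply/negP => /and3P[yx H _]; case: (touch_parts H) => /partsP[a ax] /partsP[b by_].
  by move: yx; rewrite -ax -by_ (gc a b erefl) eqxx.
apply: (@sequence_from_merge _ G _ _ _ (lab r.+1) (lab r)) => //.
- move=> g x lg gl; apply: (red_degree_between (c := lab r.+1) (c' := lab r)) => //.
    by move=> a; apply: lab_split.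
  by move=> a; apply: lab_nbrs.
- by move=> g gl lg; apply: IH => //; apply: ltnW.
- by move=> a b /fl /lab_refines.
Qed.

Hypothesis G_reg : regular d G.
Hypothesis lab_fibre : forall a, #|[set b | lab N b == lab N a]| <= t.

(** Before the descent the single vertices are merged into the fibres of [lab N]. A part then has at
    most [t] vertices with [d] neighbours each, whence [t * d]. *)
Lemma contraction_sequence_of_labels :
  has_contraction_sequence G (maxn (t * d) (K * D)).
Proof.
set w := maxn _ _.
have mono H : sequence_from (K * D) H -> sequence_from w H.
  case=> k [Hs [? ? ? Hd]]; exists k, Hs; split=> // i x ik xi.
  by rewrite (leq_trans (Hd _ _ ik xi)) // leq_maxr.
suff : sequence_from w (trigraph_of G) by [].
rewrite -quot_id; apply: (@sequence_from_merge _ G _ _ _ id (lab N)) => //.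
- move=> f x cf fc; apply: leq_trans (leq_maxl _ _).
  apply: (red_degree_between (c := id) (c' := lab N)) => //.
    by move=> a; rewrite imset_id.
  move=> a; have /forallP/(_ a)/eqP <- := G_reg; rewrite degreeE.
  apply: subset_leq_card; apply/subsetP => y /imsetP[b]; rewrite !inE.
  by move=> /existsP[a' /andP[/eqP -> ab]] ->.
- by move=> f fl lf; apply: mono; apply: (@sequence_from_labels N).
- by move=> a b ->.
Qed.

End Descent.

(** * Colourings, balls and walk weights *)

Lemma greedy_coloring (T : finType) (e : rel T) (Delta : nat) :
  symmetric e -> (forall x, #|[set y | e x y]| <= Delta) ->
  exists col : T -> 'I_Delta.+1, forall x y, e x y -> x != y -> col x != col y.
Proof.
move=> esym eD.
suff H m (S : {set T}) : #|S| <= m -> exists col : T -> 'I_Delta.+1,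
    forall x y, x \in S -> y \in S -> e x y -> x != y -> col x != col y.
  have [col Hcol] := H _ [set: T] (leqnn _).
  by exists col => x y; apply: Hcol.
elim: m S => [|m IH] S.
  by rewrite leqn0 cards_eq0 => /eqP ->; exists (fun=> ord0) => x y; rewrite inE.
move=> Sm; have [->|[z zS]] := set_0Vmem S.
  by exists (fun=> ord0) => x y; rewrite inE.
have [|col Hcol] := IH (S :\ z); first by rewrite (cardsD1 z) zS in Sm.
pose used := [set col y | y in [set y | e z y]].
have /subsetPn[i _ iN] : ~~ ([set: 'I_Delta.+1] \subset used).
  apply/negP => /subset_leq_card; rewrite cardsT card_ord leqNgt ltnS.
  by rewrite (leq_trans (leq_imset_card _ _) (eD z)).
have iz y : e z y -> col y != i.
  by move=> zy; apply: contraNneq iN => <-; apply: imset_f; rewrite inE.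
exists (fun x => if x == z then i else col x) => x y xS yS xy xNy.
have [xz|xz] := eqVneq x z; have [yz|yz] := eqVneq y z.
- by rewrite xz yz eqxx in xNy.
- by rewrite eq_sym iz -?xz.
- by rewrite iz // esym -yz.
- by apply: Hcol; rewrite // !inE ?xz ?yz.
Qed.

Section Balls.
Variables (T : finType) (G : sgraph T).

Fixpoint ball j (u : T) : {set T} :=
  if j is i.+1 then u |: \bigcup_(y in nbr G u) ball i y else [set u].

Lemma ball_center j u : u \in ball j u.
Proof. by case: j => [|j] /=; rewrite !inE eqxx. Qed.

Lemma ballSP j u x :
  reflect (x = u \/ exists2 y, adj G u y & x \in ball j y) (x \in ball j.+1 u).
Proof.
rewrite /= in_setU1; apply: (iffP orP) => -[/eqP|]; try by left.
- by case/bigcupP => y; rewrite inE; right; exists y.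
- by case=> y uy xy; right; apply/bigcupP; exists y; rewrite ?inE.
Qed.

Lemma ball_leq i j u x : i <= j -> x \in ball i u -> x \in ball j u.
Proof.
elim: i j u => [|i IH] j u; first by move=> _; rewrite inE => /eqP ->; apply: ball_center.
case: j => // j ij /ballSP[->|[y uy xy]]; first exact: ball_center.
by apply/ballSP; right; exists y => //; apply: IH.
Qed.

Lemma ball_trans i j u x z :
  x \in ball i u -> z \in ball j x -> z \in ball (i + j) u.
Proof.
elim: i u => [|i IH] u; first by rewrite inE => /eqP ->.
case/ballSP => [-> |[y uy xy] zx]; first by apply: ball_leq; apply: leq_addl.
by rewrite addSn; apply/ballSP; right; exists y => //; apply: IH.
Qed.

Lemma ball_sym j u x : (x \in ball j u) = (u \in ball j x).
Proof.
suff H v y : y \in ball j v -> v \in ball j y by apply/idP/idP; apply: H.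
elim: j v => [|j IH] v; first by rewrite !inE eq_sym.
case/ballSP => [->|[z vz yz]]; first exact: ball_center.
rewrite -addn1; apply: ball_trans (IH _ yz) _; apply/ballSP; right.
by exists v; [rewrite adj_sym|exact: ball_center].
Qed.

Lemma card_ball d j u : regular d G -> #|ball j u| <= d.+1 ^ j.
Proof.
move=> dG; elim: j u => [|j IH] u; first by rewrite cards1.
rewrite /= (leq_trans (leq_card_setU _ _)) // cards1 expnS mulSn leq_add ?expn_gt0 //.
apply: leq_trans (leq_card_bigcup_const (D := d.+1 ^ j) _) _ => //.
by rewrite -degreeE (eqP (forallP dG u)).
Qed.

End Balls.

Section Weights.
Variables (T : finType) (G : sgraph T) (D : nat).
Hypothesis G_reg : regular D.+1 G.
Hypothesis D0 : 0 < D.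
Implicit Types (u v x y : T) (j k : nat).

(* Non-backtracking walks with [j] steps from [u] to [x] whose first step does
   not go to [v]. *)
Fixpoint nbwalks j u v x : nat :=
  if j is i.+1 then \sum_(y in nbr G u | y != v) nbwalks i y u x else (x == u).

Lemma card_nbr u : #|nbr G u| = D.+1.
Proof. by rewrite -degreeE (eqP (forallP G_reg u)). Qed.

(** As [v] is a neighbour of [u], each step has exactly [D] continuations. *)
Lemma nbwalks_sum j u v : adj G u v -> \sum_x nbwalks j u v x = D ^ j.
Proof.
elim: j u v => [|j IH] u v uv.
  rewrite (bigD1 u) //= eqxx big1 ?addn0 // => x /negPf xu.
  by rewrite xu.
rewrite /= exchange_big /= (eq_bigr (fun=> D ^ j)); last first.
  by move=> y /andP[]; rewrite inE => uy _; apply: IH; rewrite adj_sym.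
rewrite sum_nat_const expnS; congr (_ * _).
have := card_nbr u; rewrite (cardsD1 v) inE uv add1n => /eq_add_S <-.
by apply: eq_card => y; rewrite -topredE /= !inE andbC.
Qed.

Lemma nbwalks_ball j u v x : 0 < nbwalks j u v x -> x \in ball G j u.
Proof.
elim: j u v => [|j IH] u v; first by rewrite /= inE; case: (x == u).
move=> /= H; have [y /andP[yu _] Hy] : exists2 y, (y \in nbr G u) && (y != v) &
    0 < nbwalks j y u x.
  apply/exists_inP; move: H; apply: contraTT => /exists_inPn N.
  by rewrite lt0n negbK big1 // => y /N; rewrite lt0n negbK => /eqP.
by apply/ballSP; right; exists y; [rewrite inE in yu|apply: IH Hy].
Qed.

Variable k : nat.

(** The share in [weight v x] of the walks from [v] whose first step goes to [u]. *)
Definition tail_weight u v x := \sum_(j < k) D ^ (k.-1 - j) * nbwalks j u v x.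

(* Every non-backtracking walk of length [j <= k] from [u] counts [D ^ (k - j)]. *)
Definition weight u x :=
  D ^ k * (x == u) + \sum_(j < k) D ^ (k.-1 - j) * \sum_(y in nbr G u) nbwalks j y u x.

Definition total_weight := D ^ k + k * (D.+1 * D ^ k.-1).
Definition fresh_weight := D ^ k + k * (D.-1 * D ^ k.-1).

Lemma tail_weight_sum u v : adj G u v -> \sum_x tail_weight u v x = k * D ^ k.-1.
Proof.
move=> uv; rewrite exchange_big /= (eq_bigr (fun=> D ^ k.-1)).
  by rewrite sum_nat_const card_ord.
move=> j _; rewrite -big_distrr /= nbwalks_sum // -expnD subnK //.
by have := ltn_ord j; case: (k) j.
Qed.

Lemma weight_sum u : \sum_x weight u x = total_weight.
Proof.
rewrite big_split /= /total_weight; congr (_ + _).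
  rewrite -big_distrr /= (bigD1 u) //= eqxx big1 ?muln1 // => x /negPf xu.
  by rewrite xu.
rewrite exchange_big /= (eq_bigr (fun=> D.+1 * D ^ k.-1)).
  by rewrite sum_nat_const card_ord.
move=> j _; rewrite -big_distrr /= exchange_big /= (eq_bigr (fun=> D ^ j)).
  rewrite sum_nat_const card_nbr mulnCA -expnD subnK //.
  by have := ltn_ord j; case: (k) j.
by move=> y; rewrite inE => uy; rewrite nbwalks_sum // adj_sym.
Qed.

(** The walks from [u] are sorted by their first step. Those avoiding [v] give the first two
    summands, the ones of full length [k] being separate because they carry no factor [D]; those
    through [v] give the last. *)
Lemma weight_split u v x : adj G u v ->
  weight u x = D * tail_weight u v x + nbwalks k u v x + tail_weight v u x.
Proof.
move=> uv.
have -> : weight u x =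
    \sum_(j < k.+1) D ^ (k - j) * nbwalks j u v x + tail_weight v u x.
  rewrite big_ord_recl /= subn0 /weight -addnA; congr (_ + _).
  rewrite /tail_weight -big_split /=; apply: eq_bigr => j _.
  rewrite (bigD1 v) ?inE //= mulnDr addnC; congr (_ * _ + _).
  by rewrite /bump /= -subn1 -subnDA.
rewrite big_ord_recr /= subnn mul1n; congr (_ + _ + _).
rewrite big_distrr /=; apply: eq_bigr => j _.
rewrite mulnA -expnS; congr (D ^ _ * _).
have := ltn_ord j; lia.
Qed.

(** Splitting [weight u x] and [weight v x] along the edge [u v], the term [tail_weight v u x] is
    cancelled and one of the [D] copies of [tail_weight u v x] as well. *)
Lemma weight_fresh u v : adj G u v ->
  \sum_x (weight u x - weight v x) <= fresh_weight.
Proof.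
move=> uv; have vu : adj G v u by rewrite adj_sym.
apply: (@leq_trans (\sum_x (D.-1 * tail_weight u v x + nbwalks k u v x))).
  apply: leq_sum => x _; rewrite (weight_split x uv) (weight_split x vu).
  have := D0; case: (D) => // D' _; rewrite !mulSn /=; lia.
rewrite big_split /= -big_distrr /= tail_weight_sum // nbwalks_sum // /fresh_weight.
by rewrite addnC mulnCA.
Qed.

Lemma weight_ball u x : 0 < weight u x -> x \in ball G k u.
Proof.
rewrite /weight addn_gt0 => /orP[|H].
  by have [->|] := eqVneq x u; [rewrite ball_center|rewrite muln0].
have [j] : exists j : 'I_k, 0 < \sum_(y in nbr G u) nbwalks j y u x.
  apply/existsP; move: H; apply: contraTT => /existsPn N.
  by rewrite lt0n negbK big1 // => j _; have := N j; rewrite lt0n negbK => /eqP ->; rewrite muln0.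
move=> {}H; have [y yu Hy] : exists2 y, y \in nbr G u & 0 < nbwalks j y u x.
  apply/exists_inP; move: H; apply: contraTT => /exists_inPn N.
  by rewrite lt0n negbK big1 // => y /N; rewrite lt0n negbK => /eqP.
apply: (@ball_leq _ _ j.+1) => //; apply/ballSP; right.
by exists y; [rewrite inE in yu|apply: nbwalks_ball Hy].
Qed.

End Weights.

(** * Random hash labels *)

Section Labels.
Variables (T : finType) (G : sgraph T) (C M W R : nat).
Variables (col : T -> 'I_C) (wt : T -> T -> nat).
Hypothesis wt_sum : forall u, \sum_x wt u x = M.
Hypothesis wt_fresh : forall u v, adj G u v -> \sum_x (wt u x - wt v x) <= W.
Hypothesis col_near : forall u v x y, (u == v) || adj G u v ->
  0 < wt u x -> 0 < wt v y -> col x = col y -> x = y.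
Hypothesis col_far : forall u v x, u != v -> col u = col v ->
  0 < wt u x -> 0 < wt v x -> False.

Notation slot := ('I_C * 'I_M)%type.
Notation hash := {ffun T * 'I_M -> 'I_R.+1}.
Notation label := ('I_C * {ffun slot -> option 'I_R.+1})%type.

(** The vertex whose string fills slot [p] of the label of [v]. By [col_near] there is at most one,
    and neighbouring vertices that both show a slot have the same owner for it. *)
Definition owner (v : T) (p : slot) : option T :=
  [pick x | (col x == p.1) && (p.2 < wt v x)].

(* The label of [v] lists the first [wt v x] characters of the string [s x] for
   every [x] near [v], where colours serve as names for these vertices; the
   alphabet is truncated to [0, ..., r]. *)
Definition label_of (s : hash) (r : nat) (v : T) : label :=
  (col v, [ffun p : slot =>
     if owner v p is Some x then Some (inord (minn (s (x, p.2)) r)) else None]).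

Definition domain (l : label) : {set slot} := [set p | l.2 p != None].

Lemma ownerP v p x : owner v p = Some x -> col x = p.1 /\ p.2 < wt v x.
Proof. by rewrite /owner; case: pickP => // y /andP[/eqP ? ?] [<-]. Qed.

Lemma ownerE v x (i : 'I_M) : i < wt v x -> owner v (col x, i) = Some x.
Proof.
move=> ix; rewrite /owner; case: pickP => [y /= /andP[/eqP yx iy]|/(_ x)].
  by congr Some; apply: (@col_near v v) => //; rewrite ?eqxx // (leq_ltn_trans _ iy, leq_ltn_trans _ ix).
by rewrite /= eqxx ix.
Qed.

Lemma mem_domain s r v p : (p \in domain (label_of s r v)) = (owner v p != None).
Proof. by rewrite inE ffunE; case: (owner v p). Qed.

Lemma label_ofE s r v p x : owner v p = Some x ->
  (label_of s r v).2 p = Some (inord (minn (s (x, p.2)) r)).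
Proof. by move=> E; rewrite ffunE E. Qed.

Lemma minn_char (s : hash) q r : minn (s q) r < R.+1.
Proof. by rewrite (leq_ltn_trans (geq_minl _ _)). Qed.

Lemma label_of_eq_minn s r a b p x y : owner a p = Some x -> owner b p = Some y ->
  (label_of s r a).2 p = (label_of s r b).2 p ->
  minn (s (x, p.2)) r = minn (s (y, p.2)) r.
Proof.
move=> ax by_; rewrite (label_ofE _ _ ax) (label_ofE _ _ by_) => -[].
by move=> /(congr1 val); rewrite /= !inordK // minn_char.
Qed.

(** Truncating at [r] factors through truncating at [r.+1]. *)
Lemma label_of_refines s r : refines (label_of s r.+1) (label_of s r).
Proof.
move=> a b ab; have ca : col a = col b by case: ab.
rewrite /label_of ca; congr pair; apply/ffunP => p; rewrite !ffunE.
have := congr1 (fun l : label => l.2 p) ab.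
case ax: (owner a p) => [x|]; case by_: (owner b p) => [y|] // E.
- have := label_of_eq_minn ax by_ E; move=> {}E; congr (Some (inord _)).
  by rewrite -(minn_idPl (leqnSn r)) [minn r _]minnC !minnA E.
- by move: E; rewrite !ffunE ax by_.
- by move: E; rewrite !ffunE ax by_.
Qed.

Lemma domain_eq s r s' r' a b : domain (label_of s r a) = domain (label_of s' r' b) ->
  forall p, (owner a p == None) = (owner b p == None).
Proof.
by move=> E p; apply/negb_inj; rewrite -(mem_domain s r) E mem_domain.
Qed.

(** The finer label only adds, for each slot showing [r], whether the letter is larger. The set of
    slots showing [r.+1] thus determines it, which keeps the bound independent of [R]. *)
Lemma label_of_split s r a : r < R ->
  #|[set label_of s r.+1 b | b in [set b | label_of s r b == label_of s r a]]|
    <= C * 2 ^ (C * M).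
Proof.
move=> rR; pose g (l : label) := (l.1, [set p | l.2 p == Some (inord r.+1)]).
rewrite -(card_in_imset (f := g)).
  apply: leq_trans (max_card _) _.
  by rewrite card_prod card_ord -cardsT -powersetT card_powerset cardsT card_prod !card_ord.
move=> l1 l2 /imsetP[b1]; rewrite inE => /eqP e1 -> /imsetP[b2]; rewrite inE => /eqP e2 -> [cb].
move/setP => E; rewrite /label_of cb; congr pair; apply/ffunP => p; rewrite !ffunE.
have eb : label_of s r b1 = label_of s r b2 by rewrite e1 e2.
have dE := domain_eq (congr1 domain eb) p.
case ax: (owner b1 p) (dE) => [x|]; case by_: (owner b2 p) => [y|] // _.
congr (Some (inord _)).
have := label_of_eq_minn ax by_ (congr1 (fun l : label => l.2 p) eb).
have := E p; rewrite !inE !ffunE ax by_ !(inj_eq (@Some_inj _)) -!val_eqE /=.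
rewrite !inordK ?minn_char //; lia.
Qed.

(** All letters have collapsed to [0], so only the colour and the domain are left. *)
Lemma label_of_0 s : #|[set label_of s 0 b | b : T]| <= C * 2 ^ (C * M).
Proof.
pose g (l : label) := (l.1, domain l).
rewrite -(card_in_imset (f := g)).
  apply: leq_trans (max_card _) _.
  by rewrite card_prod card_ord -cardsT -powersetT card_powerset cardsT card_prod !card_ord.
move=> l1 l2 /imsetP[b1 _ ->] /imsetP[b2 _ ->] [cb] dE.
rewrite /label_of cb; congr pair; apply/ffunP => p; rewrite !ffunE.
have := domain_eq dE p.
by case: (owner b1 p) => [x|]; case: (owner b2 p) => [y|]; rewrite ?minn0.
Qed.

Lemma card_fresh_slots s r a b : adj G a b ->
  #|domain (label_of s r b) :\: domain (label_of s r a)| <= W.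
Proof.
move=> ab; have ba : adj G b a by rewrite adj_sym.
apply: leq_trans (wt_fresh ba).
pose P x := [set i : 'I_M | wt a x <= i < wt b x].
apply: (@leq_trans #|\bigcup_x [set (col x, i) | i in P x]|).
  apply: subset_leq_card; apply/subsetP => p; rewrite in_setD !mem_domain negbK.
  case/andP => /eqP pa; case bx: (owner b p) => [x|] // _.
  have [px lx] := ownerP bx; apply/bigcupP; exists x => //.
  apply/imsetP; exists p.2; last by rewrite px; case: (p).
  rewrite inE lx andbT leqNgt; apply/negP => /ownerE.
  by rewrite px; case: p pa {bx lx px} => p1 p2 /= ->.
apply: leq_trans (leq_card_bigcup _ _) _; apply: leq_sum => x _.
apply: leq_trans (leq_imset_card _ _) _.
rewrite cardE -(size_map val) -(size_iota (wt a x) (wt b x - wt a x)).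
apply: uniq_leq_size; first by rewrite (map_inj_uniq val_inj) enum_uniq.
move=> i /mapP[j]; rewrite mem_enum inE => /andP[aj jb] ->.
by rewrite mem_iota aj /= subnKC // (leq_trans aj) // ltnW.
Qed.

(** On slots in its domain, the label of [a] prescribes the letters of the neighbouring label. What
    remains free is the colour, the domain and at most [W] letters in fresh slots. *)
Lemma label_of_nbrs s r a :
  #|label_nbrs G (label_of s r) (label_of s r a)| <= C * 2 ^ (C * M) * R.+1 ^ W.
Proof.
pose new (l : label) := domain l :\: domain (label_of s r a).
(* The letters in the fresh slots, in the order of [enum], padded with [ord0] to length [W]. *)
pose h (l : label) : {ffun 'I_W -> 'I_R.+1} :=
  [ffun i : 'I_W => odflt ord0 (nth None [seq l.2 p | p <- enum (new l)] i)].
pose g l := (l.1, domain l, h l).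
rewrite -(card_in_imset (f := g)).
  apply: leq_trans (max_card _) _.
  by rewrite !card_prod card_ffun !card_ord -cardsT -powersetT card_powerset cardsT card_prod !card_ord.
have hi l i : h l i = odflt ord0 (nth None [seq l.2 p | p <- enum (new l)] i).
  by rewrite ffunE.
move=> l1 l2 /imsetP[b1]; rewrite inE => /existsP[a1 /andP[/eqP e1 ab1]] ->.
move=> /imsetP[b2]; rewrite inE => /existsP[a2 /andP[/eqP e2 ab2]] -> [cb dE hE].
(* By [col_near] for the edge [a' b], a slot shown by both has a common owner, hence the same
   letter. *)
have old a' b p : label_of s r a' = label_of s r a -> adj G a' b ->
    p \in domain (label_of s r b) -> p \in domain (label_of s r a) ->
    (label_of s r b).2 p = (label_of s r a).2 p.
  move=> <- ab; rewrite !mem_domain.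
  case bx: (owner b p) => [x|] // _; case ay: (owner a' p) => [y|] // _.
  have [px lx] := ownerP bx; have [py ly] := ownerP ay.
  have xy : x = y.
    apply: (@col_near b a'); rewrite ?px ?py //; first by rewrite adj_sym ab orbT.
      exact: leq_ltn_trans lx.
    exact: leq_ltn_trans ly.
  by rewrite !ffunE bx ay xy.
rewrite /label_of cb; congr pair; apply/ffunP => p.
suff : (label_of s r b1).2 p = (label_of s r b2).2 p by [].
have [p1|p1] := boolP (p \in domain (label_of s r b1)); last first.
  move: (p1); rewrite dE; move: p1; rewrite !inE !negbK => /eqP -> /eqP -> //.
have p2 : p \in domain (label_of s r b2) by rewrite -dE.
have [pa|pa] := boolP (p \in domain (label_of s r a)).
  by rewrite (old a1) // (old a2).
have nE : new (label_of s r b1) = new (label_of s r b2) by rewrite /new dE.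
have pn : p \in enum (new (label_of s r b1)) by rewrite mem_enum in_setD pa.
set i := index p (enum (new (label_of s r b1))).
have isz : i < size (enum (new (label_of s r b1))) by rewrite index_mem.
have iW : i < W.
  apply: leq_trans isz _; rewrite -cardE /new -e1; exact: card_fresh_slots.
have : h (label_of s r b1) (Ordinal iW) = h (label_of s r b2) (Ordinal iW) by rewrite hE.
rewrite 2!hi -nE 2?(nth_map p) // nth_index //.
move: p1 p2; rewrite 2!in_set.
move: ((label_of s r b1).2 p) ((label_of s r b2).2 p).
by case=> [u|] // [v|] //= _ _ ->.
Qed.

Definition slots (v : T) : {set T * 'I_M} := [set q : T * 'I_M | q.2 < wt v q.1].

Lemma card_slots v : #|slots v| = M.
Proof.
rewrite -[RHS](wt_sum v) -sum1_card.
rewrite (eq_bigl (fun q : T * 'I_M => true && (q.2 < wt v q.1))); last by move=> q; rewrite inE.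
rewrite -(pair_big_dep xpredT (fun x (i : 'I_M) => i < wt v x) (fun _ _ => 1)) /=.
apply: eq_bigr => x _.
have wM : wt v x <= M by rewrite -(wt_sum v) (bigD1 x) //= leq_addr.
by rewrite -(big_ord_widen M (fun=> 1)) // sum_nat_const card_ord muln1.
Qed.

Lemma slots_disjoint u v q : u != v -> col u = col v ->
  q \in slots u -> q \in slots v -> False.
Proof.
by move=> uv cuv; rewrite !inE => H1 H2; apply: (col_far uv cuv);
  [apply: leq_ltn_trans H1|apply: leq_ltn_trans H2].
Qed.

Definition monochromatic (A : {set T}) : {set hash} :=
  [set s | [forall a in A, forall b in A, label_of s R a == label_of s R b]].

Lemma label_of_top s a b (x y : T) (i : 'I_M) :
  label_of s R a = label_of s R b -> col x = col y -> i < wt a x -> i < wt b y ->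
  s (x, i) = s (y, i).
Proof.
move=> E cxy ax by_; apply/val_inj => /=.
have oy : owner b (col x, i) = Some y by rewrite cxy ownerE.
have /= := label_of_eq_minn (ownerE ax) oy (congr1 (fun l : label => l.2 (col x, i)) E).
by rewrite !(minn_idPl _) // -ltnS.
Qed.

(* Outside the slots of [A :\ a], a hash in [monochromatic A] is arbitrary; on
   them it is determined by the label of [a]. *)
Lemma card_monochromatic (A : {set T}) : 0 < #|A| ->
  #|monochromatic A| * R.+1 ^ (M * #|A|.-1) <= R.+1 ^ (#|T| * M).
Proof.
case/card_gt0P => a aA; rewrite [#|A|](cardsD1 a) aA add1n /=.
have [/forall_inP cA|/forall_inPn[b bA cb]] := boolP [forall b in A, col b == col a]; last first.
  rewrite (_ : monochromatic A = set0) ?cards0 ?mul0n //.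
  apply/setP => s; rewrite !inE; apply/negP => /forall_inP/(_ b bA)/forall_inP/(_ a aA).
  by case/eqP => E _; rewrite E eqxx in cb.
set B := A :\ a; pose P := \bigcup_(v in B) slots v.
have cB v w : v \in B -> w \in B -> col v = col w.
  by rewrite !inE => /andP[_ /cA/eqP ->] /andP[_ /cA/eqP ->].
have cardP : #|B| * M <= #|P|.
  rewrite -sum_nat_const (eq_bigr (fun v => \sum_q (q \in slots v))); last first.
    by move=> v _; apply: etrans (esym (card_slots v)) _; rewrite -sum1_card big_mkcond.
  rewrite exchange_big /= -sum1_card [X in _ <= X]big_mkcond /=; apply: leq_sum => q _.
  case: ifP => [/bigcupP[v vB vq]|/negbT N].
    rewrite (bigD1 v) //= vq big1 // => w /andP[wB wv].
    apply/eqP; rewrite eqb0; apply/negP => wq; apply: (slots_disjoint wv) wq vq; exact: cB.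
  rewrite big1 // => v vB; apply/eqP; rewrite eqb0; apply: contra N => vq.
  by apply/bigcupP; exists v.
pose res (s : hash) : hash := [ffun q => if q \in P then ord0 else s q].
apply: (@leq_trans (R.+1 ^ #|~: P| * R.+1 ^ (M * #|B|))); last first.
  rewrite -expnD leq_pexp2l //.
  have <- : #|P| + #|~: P| = #|T| * M by rewrite cardsC card_prod card_ord.
  by rewrite addnC leq_add2r mulnC.
rewrite leq_mul2r; apply/orP; right.
rewrite -(card_in_imset (f := res)); last first.
  move=> s1 s2; rewrite !inE => m1 m2 /ffunP E; apply/ffunP.
  have out q : q \notin P -> s1 q = s2 q.
    by move=> qP; have := E q; rewrite !ffunE (negPf qP).
  have mono s v : [forall a in A, forall b in A, label_of s R a == label_of s R b] ->
      v \in B -> label_of s R v = label_of s R a.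
    rewrite !inE => /forall_inP H /andP[_ vA]; apply/eqP.
    by have /forall_inP := H v vA; apply.
  case=> x i; have [/bigcupP[v vB]|] := boolP ((x, i) \in P); last exact: out.
  rewrite inE /= => vx.
  (* The domains of [v] and [a] agree, so [a] shows this slot too, through some [y]. Each of the two
     hashes then has equal letters at [(x, i)] and [(y, i)], and [(y, i)] lies outside [P] by
     [col_far]. *)
  have [y [cxy ay]] : exists y, col x = col y /\ i < wt a y.
    have /eqP := mono _ _ m1 vB; have := domain_eq (congr1 domain (mono _ _ m1 vB)) (col x, i).
    rewrite (ownerE vx); case ay: (owner a _) => [y|] // _ _.
    by exists y; have [-> ?] := ownerP ay.
  rewrite (label_of_top (mono _ _ m1 vB) cxy vx ay).
  rewrite (label_of_top (mono _ _ m2 vB) cxy vx ay).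
  apply: out; apply/negP => /bigcupP[w wB wy].
  have wa : w != a by move: wB; rewrite !inE => /andP[].
  apply: (slots_disjoint wa _ wy); last by rewrite inE.
  by move: wB; rewrite !inE => /andP[_ /cA/eqP].
have <- : #|pffun_on (ord0 : 'I_R.+1) (mem (~: P)) predT| = R.+1 ^ #|~: P|.
  by rewrite card_pffun_on card_ord.
apply: subset_leq_card; apply/subsetP => _ /imsetP[s _ ->]; apply/pffun_onP.
split=> //; apply/subsetP => q; rewrite !inE ffunE; by case: ifP => //; rewrite eqxx.
Qed.

(** Union bound over the sets [A] of [t] vertices: each is monochromatic for at most a fraction
    [R.+1 ^ -(M * t.-1)] of all hashes. *)
Lemma exists_hash t : 0 < t -> 'C(#|T|, t) < R.+1 ^ (M * t.-1) ->
  exists s, forall a, #|[set b | label_of s R b == label_of s R a]| < t.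
Proof.
move=> t0 Ct.
pose bad := \bigcup_(A in [set A : {set T} | #|A| == t]) monochromatic A.
have /subsetPn[s _ sN] : ~~ ([set: hash] \subset bad).
  apply/negP => /subset_leq_card; rewrite cardsT card_ffun card_prod !card_ord leqNgt.
  case/negP; have R0 : 0 < R.+1 ^ (M * t.-1) by rewrite expn_gt0.
  rewrite -(ltn_pmul2r R0).
  apply: (@leq_ltn_trans ('C(#|T|, t) * R.+1 ^ (#|T| * M))); last first.
    by rewrite mulnC ltn_pmul2l // expn_gt0.
  rewrite -card_draws -[X in _ <= X]sum_nat_const.
  apply: leq_trans (_ : _ <= \sum_(A in [set A : {set T} | #|A| == t])
     #|monochromatic A| * R.+1 ^ (M * t.-1)) _.
    by rewrite -big_distrl /= leq_mul2r leq_card_bigcup orbT.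
  apply: leq_sum => A; rewrite inE => /eqP At; rewrite -At.
  by apply: card_monochromatic; rewrite At.
exists s => a; rewrite ltnNge; apply: contra sN => tA.
set F := [set b | _] in tA.
have [A AF At] : exists2 A : {set T}, A \subset F & #|A| = t.
  have [A /andP[AF /eqP At]] : exists A : {set T}, (A \subset F) && (#|A| == t).
    have : 0 < #|[set A : {set T} | A \subset F & #|A| == t]|.
      by rewrite cards_draws bin_gt0.
    by case/card_gt0P => A; rewrite inE; exists A.
  by exists A.
apply/bigcupP; exists A; first by rewrite inE At.
rewrite inE; apply/forall_inP => b /(subsetP AF); rewrite inE => /eqP ->.
by apply/forall_inP => c /(subsetP AF); rewrite inE eq_sym.
Qed.

End Labels.

(** * Factorial and binomial estimates *)

Lemma ffact_leq_exp n t : n ^_ t <= n ^ t.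
Proof.
rewrite ffact_prod -[in X in _ <= X](card_ord t) -prod_nat_const.
by apply: leq_prod => i _; apply: leq_subr.
Qed.

(** [t ^ t] is at most the falling factorial [(2 t) ^_ t], which is [t!] times a binomial
    coefficient below [4 ^ t]. *)
Lemma exp_leq_fact t : t ^ t <= 4 ^ t * t`!.
Proof.
apply: (@leq_trans ((t + t) ^_ t)).
  rewrite ffact_prod -[in X in X <= _](card_ord t) -prod_nat_const.
  rewrite card_ord; apply: leq_prod => i _; have := ltn_ord i; lia.
rewrite -bin_ffact leq_mul2r; apply/orP; right.
rewrite (_ : 4 ^ t = 2 ^ (t + t)); last by rewrite addnn -mul2n expnM.
rewrite -{1}(card_ord (t + t)) -[2 ^ _](_ : #|powerset [set: 'I_(t + t)]| = _); last first.
  by rewrite card_powerset cardsT card_ord.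
by rewrite -card_draws subset_leq_card //; apply/subsetP => A _; rewrite powersetE subsetT.
Qed.

(** Otherwise [R ^ (M (t - 1)) * t! <= n ^ t], so [t! <= R ^ (W t + M)]. With [t ^ t <= 4 ^ t * t!]
    and [t = 8 M R ^ W] this leaves [(2 M) ^ t <= R ^ M], whereas [R ^ M < 2 ^ (R M) <= 2 ^ t]. *)
Lemma bin_lt_hash n M W R : 0 < M -> 0 < W -> 0 < R -> n <= R ^ (M + W) ->
  'C(n, 8 * M * R ^ W) < R ^ (M * (8 * M * R ^ W).-1).
Proof.
move=> M0 W0 R0 nR; set t := 8 * M * R ^ W.
have RW : 0 < R ^ W by rewrite expn_gt0 R0.
have t0 : 0 < t by rewrite !muln_gt0 M0 RW.
rewrite ltnNge; apply/negP => H.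
have H1 : R ^ (M * t.-1) * t`! <= R ^ ((M + W) * t).
  apply: leq_trans (leq_mul H (leqnn _)) _; rewrite bin_ffact.
  by apply: leq_trans (ffact_leq_exp _ _) _; rewrite expnM leq_exp2r.
have H2 : t`! <= R ^ (W * t + M).
  rewrite -(@leq_pmul2l (R ^ (M * t.-1))) ?expn_gt0 ?R0 // -expnD.
  rewrite (_ : M * t.-1 + _ = (M + W) * t) //; case: (t) t0 => // u _ /=; lia.
have H3 : (2 * M) ^ t <= R ^ M.
  rewrite -(@leq_pmul2l (4 ^ t * R ^ (W * t))) ?muln_gt0 ?expn_gt0 ?R0 //.
  rewrite -[X in _ <= X]mulnA -expnD; apply: leq_trans (leq_mul (leqnn (4 ^ t)) H2).
  apply: leq_trans (exp_leq_fact t); rewrite {3}/t.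
  by rewrite expnM -!expnMn leq_exp2r // /t; lia.
have : R ^ M < 2 ^ t.
  apply: (@leq_trans ((2 ^ R) ^ M)); first by rewrite ltn_exp2r // ltn_expl.
  rewrite -expnM leq_exp2l // /t.
  have : R <= R ^ W by rewrite -{1}(expn1 R) leq_pexp2l.
  nia.
rewrite ltnNge => /negP; apply; apply: leq_trans H3.
by rewrite leq_exp2r //; lia.
Qed.

(** * Upper bound for a fixed walk length *)

Section UpperBound.
Variables (D k : nat).
Hypotheses (D0 : 0 < D) (k0 : 0 < k).
Let M := total_weight D k.
Let W := fresh_weight D k.
Let C := (D.+2 ^ (k + k).+1).+1.
Let K := C * 2 ^ (C * M).

Lemma fresh_weight_gt0 : 0 < W.
Proof. by rewrite /W /fresh_weight addn_gt0 expn_gt0 D0. Qed.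

Lemma total_weight_gt0 : 0 < M.
Proof. by rewrite /M /total_weight addn_gt0 expn_gt0 D0. Qed.

Lemma total_fresh_weight : M + W = 2 * k.+1 * D ^ k.
Proof.
rewrite /M /W /total_weight /fresh_weight.
by case: k k0 => // j _; case: D D0 => // E _ /=; rewrite !expnS; lia.
Qed.

Lemma tww_leq_fresh_weight (R : nat) (T : finType) (G : sgraph T) :
  0 < R -> 0 < #|T| -> regular D.+1 G -> #|T| <= R ^ (M + W) ->
  tww G <= (8 * M * D.+1 + K * K) * R ^ W.
Proof.
case: R => // R _ T0 Greg TR.
(* Radius [2 k + 1] reaches from any vertex seen by [u] to any vertex seen by a neighbour of [u],
   which yields [col_near]; radius [2 k] suffices for [col_far]. *)
pose near x y := y \in ball G (k + k).+1 x.
have near_sym : symmetric near by move=> x y; apply: ball_sym.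
have near_card x : #|[set y | near x y]| <= D.+2 ^ (k + k).+1.
  apply: leq_trans (card_ball _ x Greg); apply: subset_leq_card.
  by apply/subsetP => y; rewrite inE.
have [col Hcol] := greedy_coloring near_sym near_card.
have wt_near u v x y : (u == v) || adj G u v ->
    0 < weight G D k u x -> 0 < weight G D k v y -> near x y.
  move=> uv /weight_ball ux /weight_ball vy; rewrite /near.
  apply: (@ball_leq _ _ (k + (1 + k))); first by rewrite addnA addn1 addSn.
  apply: ball_trans (_ : u \in _) _; first by rewrite ball_sym.
  apply: ball_trans vy; apply/ballSP; case/orP: uv => [/eqP ->|uv]; first by left.
  by right; exists v => //; apply: ball_center.
have col_near u v x y : (u == v) || adj G u v ->
    0 < weight G D k u x -> 0 < weight G D k v y -> col x = col y -> x = y.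
  move=> uv ux vy cxy; apply/eqP/negPn/negP => xy.
  by have := Hcol _ _ (wt_near _ _ _ _ uv ux vy) xy; rewrite cxy eqxx.
have col_far u v x : u != v -> col u = col v ->
    0 < weight G D k u x -> 0 < weight G D k v x -> False.
  move=> uv cuv /weight_ball ux /weight_ball vx.
  suff : near u v by move/Hcol => /(_ uv); rewrite cuv eqxx.
  apply: (@ball_leq _ _ (k + k)) => //; apply: ball_trans ux _.
  by rewrite ball_sym.
have wt_sum u : \sum_x weight G D k u x = M by apply: weight_sum.
have wt_fresh u v : adj G u v -> \sum_x (weight G D k u x - weight G D k v x) <= W.
  exact: weight_fresh.
set t := 8 * M * R.+1 ^ W.
have t0 : 0 < t by rewrite /t !muln_gt0 total_weight_gt0 expn_gt0.
have Ct := bin_lt_hash total_weight_gt0 fresh_weight_gt0 (ltn0Sn R) TR.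
have [s Hs] := exists_hash wt_sum col_near col_far t0 Ct.
apply: leq_trans (tww_le (contraction_sequence_of_labels (lab := label_of col (weight G D k) s)
  (K := K) (D := K * R.+1 ^ W) (N := R) (t := t) (d := D.+1) T0 _ _ _ _ Greg _)) _.
- by move=> r; apply: label_of_refines.
- by move=> r a; exact: label_of_split.
- by move=> r a _; apply: (label_of_nbrs wt_fresh col_near).
- exact: label_of_0.
- by move=> a; apply: ltnW.
rewrite geq_max mulnDl; apply/andP; split.
  by apply: leq_trans (leq_addr _ _); rewrite /t mulnAC.
by apply: leq_trans (leq_addl _ _); rewrite mulnA.
Qed.

End UpperBound.

(** * Part maps of a contraction sequence *)

Section PartMaps.
Variables (T : finType) (G : sgraph T) (w : nat).

(** [f i a] is the name of the part of [a] after [i] contractions. Names may be reused, so the new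
    name [x] only has to avoid the surviving parts. *)
Record part_maps (k : nat) (f : nat -> T -> T) : Prop := PartMaps {
  part_maps0 : f 0 = id;
  part_maps_end : forall a b, f k a = f k b;
  part_mapsS : forall i, i < k -> exists u v x,
    [/\ u != v, x \notin parts (f i) :\: [set u; v] & f i.+1 = merge_parts (f i) u v x];
  part_maps_refine : forall i, i < k -> refines (f i) (f i.+1);
  part_maps_red : forall i x, i <= k -> red_degree (quot G (f i)) x <= w }.

Lemma exists_part_maps : has_contraction_sequence G w -> exists k f, part_maps k f.
Proof.
case=> k [H [H0 Hk HS Hd]].
have [st Hst] : exists st : nat -> T * T * T, forall i, i < k ->
    contracts (H i) (H i.+1) (st i).1.1 (st i).1.2 (st i).2.
  suff : forall i, exists s : T * T * T, i < k ->
    contracts (H i) (H i.+1) s.1.1 s.1.2 s.2 by case/choice => st Hst; exists st.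
  move=> i.
  have [/HS[u [v [x C]]]|ik] := ltnP i k; first by exists (u, v, x).
  (* Past the end of the sequence any triple will do, but a vertex is needed to form one. *)
  have [a _] : exists a, a \in vertices (H k) by apply/card_gt0P; rewrite Hk.
  by exists (a, a, a).
pose f i := iteri i (fun j g => merge_parts g (st j).1.1 (st j).1.2 (st j).2) id.
have fE i : i <= k -> H i = quot G (f i).
  elim: i => [|i IH] ik; first by rewrite H0 quot_id.
  by apply: contracts_quotE; rewrite -IH ?(ltnW ik) //; apply: Hst.
have fS i : i < k -> refines (f i) (f i.+1).
  by move=> ik a b ab; rewrite /f iteriS /merge_parts -/(f i) ab.
exists k, f; split=> //.
- have /cards1P[x fx] : #|parts (f k)| == 1 by rewrite -Hk fE.
  have fkx a : f k a = x.
    by apply/set1P; rewrite -fx; apply/partsP; exists a.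
  by move=> a b; rewrite !fkx.
- move=> i ik; exists (st i).1.1, (st i).1.2, (st i).2; split=> //.
    by case: (Hst _ ik) => -[].
  by case: (Hst _ ik) => _ [xN _] _ _ _; rewrite fE ?(ltnW ik) // in xN.
- move=> i x ik; have [xf|xf] := boolP (x \in parts (f i)).
    by rewrite -fE //; apply: Hd => //; rewrite fE.
  rewrite red_degree_quot (_ : [set y | _] = set0) ?cards0 //; apply/setP => y.
  rewrite !inE; apply/negP => /and3P[_ tx _].
  by case: (touch_parts tx) => xf' _; rewrite xf' in xf.
Qed.

Section Fixed.
Variables (k : nat) (f : nat -> T -> T).
Hypothesis fP : part_maps k f.

Definition part i a : {set T} := [set b | f i b == f i a].

Lemma part_maps_mono i j : i <= j -> j <= k -> refines (f i) (f j).
Proof.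
move=> ij; rewrite -(subnKC ij); elim: (j - i) => [|m IH] jk; first by rewrite addn0.
rewrite addnS in jk *; move=> a b /(IH (ltnW jk)); exact: (part_maps_refine fP jk).
Qed.

(** The fibre over the new name is the union of the fibres over [u] and [v], and every other fibre
    keeps its name. *)
Lemma merged_pair i : i < k -> exists u v,
  (forall a b, f i a != f i b -> f i.+1 a = f i.+1 b ->
    [set f i a; f i b] = [set u; v]) /\
  (forall a b, f i a \in [set u; v] -> f i.+1 b = f i.+1 a -> f i b \in [set u; v]).
Proof.
move=> ik; have [u [v [x [uv xN fE]]]] := part_mapsS fP ik.
have xE c : (f i.+1 c == x) = (f i c \in [set u; v]).
  rewrite !inE fE /merge_parts; case: ifPn => [_|N]; first by rewrite eqxx.
  apply: contraNF xN => /eqP <-; rewrite !inE N; apply/partsP; by exists c.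
have outE c : f i.+1 c != x -> f i.+1 c = f i c.
  by rewrite xE !inE fE /merge_parts => /negPf ->.
exists u, v; split=> [a b ab E|a b]; last by rewrite -!xE => ax ->.
have [ax|ax] := eqVneq (f i.+1 a) x; last first.
  have bx : f i.+1 b != x by rewrite -E.
  by move: E; rewrite (outE a) // (outE b) // => E'; rewrite E' eqxx in ab.
have bx : f i.+1 b == x by rewrite -E ax.
move/eqP: ax => ax; move: ax bx ab; rewrite !xE !inE.
case/orP => /eqP -> /orP[]/eqP -> H //; first by rewrite eqxx in H.
  by rewrite setUC.
by rewrite eqxx in H.
Qed.

End Fixed.
End PartMaps.

(** * Balanced partitions from contraction sequences *)

Section LaminarOrder.
Variables (T : finType) (f : nat -> T -> T) (k : nat).
Hypothesis f0 : f 0 = id.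
Hypothesis f_mono : forall i j, i <= j -> j <= k -> refines (f i) (f j).

(* Vertices are compared lexicographically by the names of their parts, the
   latest part first, so that every part of every stage is an interval. *)
Fixpoint merge_key m (a : T) : nat :=
  if m is i.+1 then merge_key i a + enum_rank (f i a) * #|T| ^ i else 0.

Lemma merge_key_lt m a : merge_key m a < #|T| ^ m.
Proof.
elim: m => // m IH; rewrite expnS /=.
apply: (@leq_trans ((enum_rank (f m a)).+1 * #|T| ^ m)); first by rewrite mulSn ltn_add2r.
by rewrite leq_mul2r ltn_ord orbT.
Qed.

Lemma leading_digit_leq N p q r s : p < N -> q < N ->
  p + r * N <= q + s * N -> r <= s.
Proof.
move=> pN qN; apply: contraTT; rewrite -!ltnNge => sr.
apply: (@leq_trans (s.+1 * N)); first by rewrite mulSn ltn_add2r.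
by apply: (@leq_trans (r * N)); [rewrite leq_mul2r sr orbT|rewrite leq_addl].
Qed.

Lemma merge_key_interval m i a b x : i < m -> m <= k.+1 -> f i a = f i b ->
  merge_key m a <= merge_key m x <= merge_key m b -> f i x = f i a.
Proof.
elim: m => // m IH; rewrite ltnS => im mk fab /=.
have fm : f m a = f m b by apply: (f_mono im).
have Ka := merge_key_lt m a; have Kb := merge_key_lt m b; have Kx := merge_key_lt m x.
rewrite -fm => /andP[H1 H2].
have rx : enum_rank (f m x) = enum_rank (f m a) :> nat.
  (* The leading digits of [a] and [b] agree, so that of [x] is squeezed between them; the remaining
     digits are handled by induction. *)
  by apply/eqP; rewrite eqn_leq (leading_digit_leq Kx Kb H2) (leading_digit_leq Ka Kx H1).
have fx : f m x = f m a by apply/enum_rank_inj/val_inj.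
move: im; rewrite leq_eqVlt => /orP[/eqP -> //|im].
by apply: IH fab _ => //; [apply: ltnW|move: H1 H2; rewrite fx; lia].
Qed.

Notation key := (merge_key k.+1).

Lemma key_inj : injective key.
Proof.
move=> a b ab; have := @merge_key_interval k.+1 0 a a b isT (leqnn _) erefl.
by rewrite f0 ab leqnn /= => ->.
Qed.

Definition position a := #|[set x | key x < key a]|.

Lemma position_mono a b : (position a <= position b) = (key a <= key b).
Proof.
apply/idP/idP => [|ab]; last first.
  apply: subset_leq_card; apply/subsetP => x; rewrite !inE => xa.
  exact: leq_trans xa ab.
rewrite leqNgt [_ <= key b]leqNgt; apply: contra => ba.
apply: proper_card; apply/properP; split.
  by apply/subsetP => x; rewrite !inE => xb; apply: ltn_trans ba.
by exists b; rewrite inE ?ltnn.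
Qed.

Lemma position_lt a : position a < #|T|.
Proof.
rewrite -cardsT; apply: proper_card; apply/properP; split; first exact: subsetT.
by exists a; rewrite ?inE ?ltnn.
Qed.

Lemma position_inj : injective position.
Proof.
move=> a b ab; apply: key_inj; apply/eqP; rewrite eqn_leq.
by rewrite -!position_mono ab leqnn.
Qed.

Lemma position_surj p : p < #|T| -> exists a, position a = p.
Proof.
move=> pT; have inj : injective (fun a => Ordinal (position_lt a)).
  by move=> a b /(congr1 val) /position_inj.
have [|g _ gK] := inj_card_bij inj; first by rewrite card_ord.
by exists (g (Ordinal pT)); have /(congr1 val) := gK (Ordinal pT).
Qed.

Lemma position_interval i a b x : i <= k -> f i a = f i b ->
  position a <= position x <= position b -> f i x = f i a.
Proof.
by move=> ik fab; rewrite !position_mono; apply: merge_key_interval.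
Qed.

End LaminarOrder.

Lemma card_le2_of_extremes (I : finType) (v : I -> nat) (Q : {set I}) :
  injective v ->
  (forall p q r, p \in Q -> q \in Q -> r \in Q -> v p < v q -> v q < v r -> False) ->
  #|Q| <= 2.
Proof.
move=> vinj H; have [->|[q0 q0Q]] := set_0Vmem Q; first by rewrite cards0.
have [lo loQ Hlo] := @arg_minnP _ q0 (mem Q) v q0Q.
have [hi hiQ Hhi] := @arg_maxnP _ q0 (mem Q) v q0Q.
apply: (@leq_trans #|[set lo; hi]|); last by rewrite cards2; case: (_ == _).
apply: subset_leq_card; apply/subsetP => q qQ; rewrite !inE.
apply: contraT; rewrite negb_or => /andP[ql qh]; exfalso.
apply: (H lo q hi) => //; rewrite ltn_neqAle.
  by rewrite (inj_eq vinj) eq_sym ql Hlo.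
by rewrite (inj_eq vinj) qh /=; apply: Hhi.
Qed.

(** The cap [(n %/ S).-1] sends the remainder, shorter than [S], to the last chunk, so no chunk
    reaches beyond length [2 * S]. *)
Lemma chunk_bounds S n p : 0 < S -> S <= n -> p < n ->
  minn (p %/ S) (n %/ S).-1 * S <= p < minn (p %/ S) (n %/ S).-1 * S + 2 * S.
Proof.
move=> S0 Sn pn; have m0 : 0 < n %/ S by rewrite divn_gt0.
apply/andP; split.
  by apply: leq_trans (leq_trunc_div p S); rewrite leq_mul2r geq_minl orbT.
rewrite -mulnDl; have [le|lt] := leqP (p %/ S) (n %/ S).-1.
  by apply: leq_trans (ltn_ceil p S0) _; rewrite leq_mul2r orbC; apply/orP; left; lia.
apply: ltn_trans pn _; apply: leq_trans (ltn_ceil n S0) _.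
by rewrite leq_mul2r orbC; apply/orP; left; lia.
Qed.

Section Chunks.
Variables (T : finType) (G : sgraph T) (w d S : nat).
Hypothesis G_reg : regular d G.
Hypotheses (S_gt1 : 1 < S) (S_gtd : d < S) (S_le : S <= #|T|).
Variables (k : nat) (f : nat -> T -> T).
Hypothesis fP : part_maps G w k f.

Notation pos := (position f k).
Notation m := (#|T| %/ S).

Lemma chunks_gt0 : 0 < m.
Proof. by rewrite divn_gt0 // ltnW. Qed.

Lemma chunk_lt a : minn (pos a %/ S) m.-1 < m.
Proof. by have := chunks_gt0; lia. Qed.

(* The last chunk takes the remainder, so that no chunk has fewer than [S]
   elements. *)
Definition chunk a : 'I_m := Ordinal (chunk_lt a).

Let f_mono := part_maps_mono fP.
Let f0 := part_maps0 fP.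

Lemma chunk_mono a b : pos a <= pos b -> chunk a <= chunk b.
Proof. by move=> ab /=; have := leq_div2r S ab; lia. Qed.

Lemma chunk_pos_lt a b : chunk a < chunk b -> pos a < pos b.
Proof. by move=> ab; rewrite ltnNge; apply/negP => /chunk_mono; rewrite leqNgt ab. Qed.

Lemma card_chunk_le (j : 'I_m) : #|[set a | chunk a == j]| <= 2 * S.
Proof.
have bound a : chunk a = j -> j * S <= pos a < j * S + 2 * S.
  by move=> <-; apply: chunk_bounds; rewrite ?position_lt // ltnW.
have [N E] : exists N, 2 * S = N.+1 by exists (2 * S).-1; have := S_gt1; lia.
rewrite E -[N.+1]card_ord -[X in _ <= X]cardsT.
pose g a : 'I_N.+1 := inord (pos a - j * S).
rewrite -(card_in_imset (f := g)); first by rewrite subset_leq_card // subsetT.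
move=> a b; rewrite !inE => /eqP aj /eqP bj.
have := bound _ aj; have := bound _ bj => Hb Ha.
move/(congr1 val); rewrite /= !inordK; try lia.
by move=> E'; apply: (position_inj f0 f_mono); lia.
Qed.

Lemma card_chunk_ge (j : 'I_m) : S <= #|[set a | chunk a == j]|.
Proof.
have jT : (j.+1) * S <= #|T|.
  by apply: leq_trans (leq_trunc_div #|T| S); rewrite leq_mul2r ltn_ord orbT.
have ex (i : 'I_S) : exists a, pos a = j * S + i.
  by apply: (position_surj f0 f_mono); have := ltn_ord i; lia.
have [g gE] := choice ex.
have cardg : #|[set g i | i in [set: 'I_S]]| = S.
  rewrite card_in_imset ?cardsT ?card_ord //.
  by move=> i i' _ _ ii'; have := gE i'; rewrite -ii' gE => /addnI /val_inj.
apply: (@leq_trans #|[set g i | i in [set: 'I_S]]|); first by rewrite cardg.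
apply: subset_leq_card; apply/subsetP => a /imsetP[i _ ->]; rewrite inE.
apply/eqP/val_inj => /=; rewrite gE divnMDl ?(ltnW S_gt1) // (divn_small (ltn_ord i)) addn0.
by apply/minn_idPl; rewrite -ltnS (prednK chunks_gt0).
Qed.

Definition joined i (j : 'I_m) :=
  [forall a, forall b, (chunk a == j) && (chunk b == j) ==> (f i a == f i b)].

Lemma joinedP i j : reflect (forall a b, chunk a = j -> chunk b = j -> f i a = f i b)
  (joined i j).
Proof.
apply: (iffP forallP) => [H a b /eqP aj /eqP bj|H a].
  by have /forallP/(_ b) := H a; rewrite aj bj => /eqP.
by apply/forallP => b; apply/implyP => /andP[/eqP ? /eqP ?]; apply/eqP/H.
Qed.

Lemma joined_end j : joined k j.
Proof. by apply/joinedP => a b _ _; apply: (part_maps_end fP). Qed.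

Lemma ex_joined j : exists i, joined i j.
Proof. by exists k; apply: joined_end. Qed.

Definition join_time j := ex_minn (ex_joined j).

Lemma join_timeP j : [/\ joined (join_time j) j, join_time j <= k &
  forall i, i < join_time j -> ~~ joined i j].
Proof.
rewrite /join_time; case: ex_minnP => i ij Hi; split=> //; first exact/Hi/joined_end.
by move=> i' i'i; apply/negP => /Hi; rewrite leqNgt i'i.
Qed.

Lemma chunk_inhabited j : exists a, chunk a = j.
Proof.
have : 0 < #|[set a | chunk a == j]| by apply: leq_trans (card_chunk_ge j); apply: ltnW.
by case/card_gt0P => a; rewrite inE => /eqP; exists a.
Qed.

Lemma join_time_gt0 j : 0 < join_time j.
Proof.
have : 1 < #|[set a | chunk a == j]| by apply: leq_trans (card_chunk_ge j).
case/card_gt1P => a [b []]; rewrite !inE => /eqP aj /eqP bj ab.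
rewrite lt0n; apply/negP => /eqP E; have [/joinedP J _ _] := join_timeP j.
by have := J a b aj bj; rewrite E f0 => /eqP; rewrite (negPf ab).
Qed.

Lemma part_interval i a b x : i <= k -> f i a = f i b ->
  pos a <= pos x <= pos b -> f i x = f i a.
Proof. by move=> ik; apply: position_interval. Qed.

(* Two intervals are merged, and only one chunk can meet both of them. *)
Lemma join_time_inj : injective join_time.
Proof.
move=> p q pq; apply: contrapT => /eqP; move: pq; wlog : p q / (p < q)%N.
  move=> H pq pNq; have [lt|lt|/val_inj E] := ltngtP p q.
  - exact: H lt pq pNq.
  - by apply: H lt (esym pq) _; rewrite eq_sym.
  - by rewrite E eqxx in pNq.
move=> lt_pq pq _.
have [/joinedP Jp pk Np] := join_timeP p; have [/joinedP Jq _ Nq] := join_timeP q.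
have := join_time_gt0 p; case E: (join_time p) => [|i] // _.
rewrite -pq E in Jp Jq Np Nq pk.
have [a [a' [aj a'j faa']]] : exists a a', [/\ chunk a = p, chunk a' = p & f i a != f i a'].
  have /forallPn[a /forallPn[a']] := Np i (ltnSn i).
  by rewrite negb_imply => /andP[/andP[/eqP ? /eqP ?] ?]; exists a, a'.
wlog aa' : a a' aj a'j faa' / pos a < pos a'.
  move=> H; have [lt|lt|/(position_inj f0 f_mono) e] := ltngtP (pos a) (pos a').
  - exact: (H a a').
  - by apply: (H a' a) => //; rewrite eq_sym.
  - by rewrite e eqxx in faa'.
have [b [b' [bj b'j fbb']]] : exists b b', [/\ chunk b = q, chunk b' = q & f i b != f i b'].
  have /forallPn[b /forallPn[b']] := Nq i (ltnSn i).
  by rewrite negb_imply => /andP[/andP[/eqP ? /eqP ?] ?]; exists b, b'.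
have [u [v [Huv _]]] := merged_pair fP pk.
have Ea := Huv _ _ faa' (Jp _ _ aj a'j); have Eb := Huv _ _ fbb' (Jq _ _ bj b'j).
(* The same two parts merge for both chunks, so the part of [a] also meets chunk [q]. Being an
   interval, it would contain [a'], which lies between. *)
have [c cj fc] : exists2 c, chunk c = q & f i a = f i c.
  have : f i a \in [set f i b; f i b'] by rewrite Eb -Ea !inE eqxx.
  by rewrite !inE => /orP[]/eqP; [exists b|exists b'].
have a'c : pos a' < pos c by apply: chunk_pos_lt; rewrite a'j cj.
have := part_interval (ltnW pk) fc (x := a'); rewrite (ltnW aa') (ltnW a'c) => /(_ isT) E'.
by rewrite E' eqxx in faa'.
Qed.

(** Adjacencies between chunks are directed towards the chunk that is joined later, so that each is
    counted when its other end becomes part of a single large part. *)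
Definition later_nbrs p : {set 'I_m} :=
  [set q | [exists a, exists b,
    [&& chunk a == p, chunk b == q, adj G a b & join_time p <= join_time q]]].

Lemma part_card_ge i a : i <= k -> (exists2 j, joined i j & chunk a = j) ->
  S <= #|part f i a|.
Proof.
move=> ik [j /joinedP J aj]; apply: leq_trans (card_chunk_ge j) _.
by apply: subset_leq_card; apply/subsetP => b; rewrite !inE => /eqP bj; apply/eqP/J.
Qed.

(** A vertex completely adjacent to the part would have more than [d] neighbours; so a part larger
    than [d] has only red edges. *)
Lemma not_full i a y : d < #|part f i a| -> y \in parts (f i) ->
  ~~ full G (f i) (f i a) y.
Proof.
move=> da /partsP[b by_]; apply/negP => /fullP F.
suff : #|part f i a| <= d by rewrite leqNgt da.
rewrite -(eqP (forallP G_reg b)) degreeE; apply: subset_leq_card.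
by apply/subsetP => c; rewrite !inE => /eqP ca; rewrite adj_sym; apply: F.
Qed.

(** At time [join_time p] the part containing [p] sees itself and at most [w] others. Each of these
    intervals meets at most two chunks not yet joined, since a middle one would lie inside it.
    Adding [p] itself gives [1 + 2 (w + 1)]. *)
Lemma card_later_nbrs p : #|later_nbrs p| <= 2 * w + 3.
Proof.
have [Jp ik _] := join_timeP p; set i := join_time p in Jp ik.
have [a0 a0p] := chunk_inhabited p.
have Sp : d < #|part f i a0|.
  by apply: leq_trans S_gtd _; apply: part_card_ge => //; exists p.
pose Y := f i a0 |: [set y | [&& y != f i a0, touch G (f i) (f i a0) y &
  ~~ full G (f i) (f i a0) y]].
pose Q y := [set q | (i < join_time q) && [exists b, (chunk b == q) && (f i b == y)]].
have cardY : #|Y| <= w.+1.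
  rewrite /Y (leq_trans (leq_card_setU _ _)) // cards1 ltnS -red_degree_quot.
  exact: (part_maps_red fP).
have cardQ y : #|Q y| <= 2.
  apply: (card_le2_of_extremes (v := fun q : 'I_m => nat_of_ord q)); first exact: val_inj.
  move=> q1 q2 q3; rewrite !inE => /andP[_ /existsP[b1 /andP[/eqP b1q /eqP b1y]]].
  move=> /andP[iq2 _] /andP[_ /existsP[b3 /andP[/eqP b3q /eqP b3y]]] q12 q23.
  have [_ _ /(_ _ iq2) /negP] := join_timeP q2; apply; apply/joinedP => a b aq bq.
  have E c : chunk c = q2 -> f i c = y.
    move=> cq; rewrite -b1y; apply: (part_interval (b := b3)) => //; first by rewrite b1y.
    by apply/andP; split; apply: ltnW; apply: chunk_pos_lt; rewrite ?cq ?b1q ?b3q.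
  by rewrite !E.
apply: (@leq_trans (1 + #|Y| * 2)); last by lia.
apply: leq_trans (_ : #|[set p] :|: \bigcup_(y in Y) Q y| <= _).
  apply: subset_leq_card; apply/subsetP => q; rewrite inE.
  case/existsP => a /existsP[b /and4P[/eqP ap /eqP bq ab]].
  rewrite leq_eqVlt => /orP[/eqP /join_time_inj ->|iq]; first by rewrite !inE eqxx.
  rewrite in_setU; apply/orP; right; apply/bigcupP; exists (f i b); last first.
    by rewrite inE iq; apply/existsP; exists b; rewrite bq !eqxx.
  have fa : f i a = f i a0 by move/joinedP: Jp; apply; rewrite ?ap.
  have nf : ~~ full G (f i) (f i a0) (f i b).
    by apply: not_full => //; apply/partsP; exists b.
  have tch : touch G (f i) (f i a0) (f i b) by apply/touchP; exists a, b.
  by rewrite !inE nf tch !andbT; case: eqP.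
apply: leq_trans (leq_card_setU _ _) _; rewrite cards1 leq_add2l.
exact: leq_card_bigcup_const.
Qed.

End Chunks.

Lemma balanced_partition (T : finType) (G : sgraph T) (w d S : nat) :
  regular d G -> 1 < S -> d < S -> S <= #|T| -> has_contraction_sequence G w ->
  exists (c : T -> 'I_(#|T| %/ S)) (E : {set 'I_(#|T| %/ S) * 'I_(#|T| %/ S)}),
  [/\ forall j, #|[set a | c a == j]| <= 2 * S, #|E| <= (#|T| %/ S) * (2 * w + 3) &
    forall a b, adj G a b -> ((c a, c b) \in E) || ((c b, c a) \in E)].
Proof.
move=> Greg S1 Sd ST /exists_part_maps[k [f fP]].
exists (chunk Greg S1 Sd ST k f), [set pq | pq.2 \in later_nbrs Greg S1 Sd ST fP pq.1]; split.
- exact: (card_chunk_le Greg S1 Sd ST fP).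
- apply: leq_trans (_ : #|\bigcup_(p in [set: 'I_(#|T| %/ S)])
      [set (p, q) | q in later_nbrs Greg S1 Sd ST fP p]| <= _).
    apply: subset_leq_card; apply/subsetP => -[p q]; rewrite inE /= => H.
    by apply/bigcupP; exists p; rewrite ?inE //; apply: imset_f.
  apply: leq_trans (leq_card_bigcup_const (D := 2 * w + 3) _) _; last first.
    by rewrite cardsT card_ord.
  by move=> p _; apply: leq_trans (leq_imset_card _ _) _; apply: card_later_nbrs.
- move=> a b ab; rewrite !inE /=.
  have [le|/ltnW le] := leqP (join_time Greg S1 Sd ST fP (chunk Greg S1 Sd ST k f a))
    (join_time Greg S1 Sd ST fP (chunk Greg S1 Sd ST k f b)); apply/orP; [left|right].
    by apply/existsP; exists a; apply/existsP; exists b; rewrite !eqxx ab.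
  by apply/existsP; exists b; apply/existsP; exists a; rewrite !eqxx adj_sym ab.
Qed.

(** Without red edges, a part with more than [d] vertices is closed under adjacency. At the first
    time the part of [v] is that large, either it has at most [2 d] vertices, or the part just
    merged into it was itself large and closed; then the old part of [v] is closed too. *)
Lemma closed_set_of_tww0 (T : finType) (G : sgraph T) d v :
  regular d G -> 0 < d -> d < #|T| -> has_contraction_sequence G 0 ->
  exists2 A : {set T}, v \in A & #|A| <= 2 * d /\
    forall a b, a \in A -> adj G a b -> b \in A.
Proof.
move=> Greg d0 dT /exists_part_maps[k [f fP]].
have closed i a : i <= k -> d < #|part f i a| -> forall x y,
    x \in part f i a -> adj G x y -> y \in part f i a.
  move=> ik da x y; rewrite !inE => /eqP xa xy; apply: contraT => yN.
  have := part_maps_red fP (f i a) ik; rewrite red_degree_quot leqn0 cards_eq0.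
  move/eqP/setP/(_ (f i y)); rewrite !inE yN /= => /negP/negP; rewrite negb_and.
  case/orP => [/touchP[]|]; first by exists x, y.
  rewrite (not_full Greg) //; by apply/partsP; exists y.
have ex : exists i, d < #|part f i v|.
  exists k; rewrite (_ : part f k v = setT) ?cardsT //; apply/setP => x.
  by rewrite !inE; apply/eqP/(part_maps_end fP).
case: (ex_minnP ex) => i di Hi.
have ik : i <= k.
  apply: Hi; rewrite (_ : part f k v = setT) ?cardsT //; apply/setP => x.
  by rewrite !inE; apply/eqP/(part_maps_end fP).
have mem_part j : v \in part f j v by rewrite inE.
case: i di Hi ik => [|i] di Hi ik.
  move: di; rewrite (_ : part f 0 v = [set v]) ?cards1; last first.
    by apply/setP => x; rewrite !inE (part_maps0 fP).
  by rewrite ltnS leqNgt d0.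
have small : #|part f i v| <= d by rewrite leqNgt; apply/negP => /Hi; rewrite ltnn.
pose O := part f i.+1 v :\: part f i v.
have PO : part f i.+1 v = part f i v :|: O.
  apply/esym; rewrite /O setDE setUIr setUCr setIT; apply/setUidPr/subsetP => x.
  by rewrite !inE => /eqP xv; apply/eqP/(part_maps_refine fP ik).
have [O_small|O_big] := leqP #|O| d.
  exists (part f i.+1 v) => //; split; last exact: closed.
  by rewrite PO (leq_trans (leq_card_setU _ _)) // mul2n -addnn leq_add.
have [o oO] : exists o, o \in O by apply/card_gt0P; apply: leq_ltn_trans O_big.
have [p [q [Hpq _]]] := merged_pair fP ik.
have Opart x : x \in O -> f i x = f i o.
  move: oO; rewrite !inE => /andP[ov /eqP ov1] /andP[xv /eqP xv1].
  have : f i x \in [set f i o; f i v] by rewrite (Hpq o v) // -(Hpq x v) // !inE eqxx.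
  by rewrite !inE (negPf xv) orbF => /eqP.
have o_big : d < #|part f i o|.
  apply: leq_trans O_big _; apply: subset_leq_card; apply/subsetP => x /Opart.
  by rewrite inE => /eqP.
exists (part f i v) => //; split; first by rewrite (leq_trans small) // leq_pmull.
move=> a b av ab; apply: contraT => bN.
have bO : b \in O.
  rewrite inE bN (closed i.+1 v ik di a) // PO in_setU av //.
have : a \in part f i o.
  by apply: (closed i o (ltnW ik) o_big b); rewrite ?inE ?Opart // adj_sym.
move: av oO; rewrite !inE => /eqP -> /andP[ov _] /eqP E; by rewrite E eqxx in ov.
Qed.

(** * Counting graphs of small twin-width *)

Section Counting.
Variable T : finType.
Implicit Types (G : sgraph T) (A : {set {set T}}).

Lemma handshake d G : regular d G -> 2 * #|edges G| = #|T| * d.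
Proof.
move=> /forallP Greg; rewrite mulnC -!sum_nat_const.
rewrite (eq_bigr (fun e : {set T} => \sum_(v : T) (v \in e))); last first.
  by move=> e /(forall_inP (edgesP G))/eqP <-; rewrite -sum1_card big_mkcond.
rewrite exchange_big /=; apply: eq_bigr => v _; rewrite -(eqP (Greg v)) /degree.
rewrite -sum1_card [RHS](eq_bigl (fun e => (e \in edges G) && (v \in e))); last first.
  by move=> e; rewrite inE.
by rewrite big_mkcondr.
Qed.

Lemma card_graphs_with_edges_in A e :
  #|[set G | (edges G \subset A) && (#|edges G| == e)]| <= 'C(#|A|, e).
Proof.
rewrite -cards_draws -(card_imset _ (val_inj : injective (@edges T))).
by apply: subset_leq_card; apply/subsetP => E /imsetP[G]; rewrite inE => H ->; rewrite inE.
Qed.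

Lemma card_graphs_with_subset_edges A : #|[set G | edges G \subset A]| <= 2 ^ #|A|.
Proof.
rewrite -card_powerset -(card_imset _ (val_inj : injective (@edges T))).
by apply: subset_leq_card; apply/subsetP => E /imsetP[G]; rewrite inE => H ->; rewrite powersetE.
Qed.

(** A set of size at most [h] is listed as a word of length [h], with [None] as padding. *)
Lemma card_small_sets (X : finType) h : #|[set E : {set X} | #|E| <= h]| <= #|X|.+1 ^ h.
Proof.
pose im (g : {ffun 'I_h -> option X}) := [set x | Some x \in codom g].
rewrite -card_option -{2}(card_ord h) -card_ffun -cardsT.
apply: leq_trans (leq_imset_card im _); apply: subset_leq_card.
apply/subsetP => E; rewrite inE => Eh; apply/imsetP.
exists [ffun i : 'I_h => nth None [seq Some x | x <- enum E] i] => //.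
apply/setP => x; rewrite inE; apply/idP/codomP => [xE|[i]].
  have xe : x \in enum E by rewrite mem_enum.
  have ih : index x (enum E) < h.
    by apply: leq_trans Eh; rewrite cardE index_mem.
  by exists (Ordinal ih); rewrite ffunE /= (nth_map x) ?index_mem // nth_index.
rewrite ffunE; have [ie|ie] := ltnP i (size (enum E)); last first.
  by rewrite nth_default // size_map.
by rewrite (nth_map x) // => -[->]; rewrite -mem_enum mem_nth.
Qed.

Definition pairs_between (L : finType) (c : T -> L) (p : L * L) : {set {set T}} :=
  [set [set x; y] | x in [set a | c a == p.1], y in [set a | c a == p.2]].

Lemma card_pairs_between (L : finType) (c : T -> L) p s :
  (forall j, #|[set a | c a == j]| <= s) -> #|pairs_between c p| <= s * s.
Proof.
move=> cs; rewrite /pairs_between curry_imset2X.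
by apply: leq_trans (leq_imset_card _ _) _; rewrite cardsX leq_mul.
Qed.

Lemma pairs_betweenP (L : finType) (c : T -> L) G (E : {set L * L}) :
  (forall a b, adj G a b -> ((c a, c b) \in E) || ((c b, c a) \in E)) ->
  edges G \subset \bigcup_(p in E) pairs_between c p.
Proof.
move=> H; apply/subsetP => e eG.
have /cards2P[x [y [_ eE]]] := forall_inP (edgesP G) _ eG.
have : adj G x y by rewrite /adj -eE.
move/H => /orP[xyE|yxE]; apply/bigcupP; [exists (c x, c y)|exists (c y, c x)] => //;
  apply/imset2P; [exists x y|exists y x]; rewrite ?inE ?eqxx // eE setUC //.
Qed.

Lemma bin_leq_pow (N e K : nat) : 0 < e -> 4 * N <= e * K -> 'C(N, e) <= K ^ e.
Proof.
move=> e0 AK; rewrite -(@leq_pmul2l (e ^ e)) ?expn_gt0 ?e0 //.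
apply: (@leq_trans (4 ^ e * (e`! * 'C(N, e)))).
  by rewrite mulnA leq_mul2r exp_leq_fact orbT.
rewrite [e`! * _]mulnC bin_ffact -expnMn.
apply: leq_trans (leq_mul (leqnn _) (ffact_leq_exp _ _)) _.
by rewrite -expnMn leq_exp2r.
Qed.

(** The factors count the maps to chunks, the sets of adjacent pairs of chunks, and the choices of
    [e] edges inside these pairs. *)
Lemma card_small_tww d w S e : 0 < d -> 1 < S -> d < S -> S <= #|T| ->
  2 * e = #|T| * d ->
  #|[set G : sgraph T | regular d G & tww G <= w]| <=
  (#|T| %/ S) ^ #|T| * #|T| ^ (2 * (#|T| %/ S * (2 * w + 3))) * (64 * ((w + 2) * S)) ^ e.
Proof.
move=> d0 S1 Sd ST eE; set n := #|T| in ST eE *; set m := n %/ S.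
set h := m * (2 * w + 3).
have n0 : 0 < n by apply: leq_trans ST; apply: ltnW.
have e0 : 0 < e by rewrite -(@ltn_pmul2l 2) // muln0 eE muln_gt0 n0.
have mS : m * S <= n by apply: leq_trunc_div.
(* Strictness absorbs the successor in [card_small_sets]. *)
have mn : m ^ 2 < n ^ 2.
  rewrite ltn_exp2r //; apply: (@leq_trans (m * S)) => //.
  have m0 : 0 < m by rewrite divn_gt0 // ltnW.
  by rewrite -{1}(muln1 m) ltn_pmul2l.
pose graphs (c : {ffun T -> 'I_m}) (E : {set 'I_m * 'I_m}) :=
  [set G : sgraph T | (edges G \subset \bigcup_(p in E) pairs_between c p) && (#|edges G| == e)].
pose cs := [set c : {ffun T -> 'I_m} | [forall j, #|[set a | c a == j]| <= 2 * S]].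
pose Es := [set E : {set 'I_m * 'I_m} | #|E| <= h].
apply: (@leq_trans #|\bigcup_(c in cs) \bigcup_(E in Es) graphs c E|).
  apply: subset_leq_card; apply/subsetP => G; rewrite inE => /andP[Greg Gw].
  have Hw : has_contraction_sequence G w.
    have [k [H [? ? ? Hd]]] := tww_has G n0.
    by exists k, H; split=> // i x ik xH; apply: leq_trans Gw; apply: Hd.
  have [c [E [cS Eh cE]]] := balanced_partition Greg S1 Sd ST Hw.
  apply/bigcupP; exists [ffun a => c a].
    rewrite inE; apply/forallP => j; apply: leq_trans (cS j).
    by apply: subset_leq_card; apply/subsetP => a; rewrite !inE ffunE.
  apply/bigcupP; exists E; first by rewrite inE.
  rewrite inE; apply/andP; split; last first.
    by rewrite -(eqn_pmul2l (isT : 0 < 2)) (handshake Greg) eE.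
  by apply: pairs_betweenP => a b ab; rewrite !ffunE; apply: cE.
have cs_card : #|cs| <= m ^ n.
  by apply: leq_trans (max_card _) _; rewrite card_ffun card_ord.
have Es_card : #|Es| <= n ^ (2 * h).
  apply: leq_trans (card_small_sets _ h) _; rewrite card_prod !card_ord expnM.
  by case: (h) => [|h0]; rewrite ?expn0 ?leq_exp2r // -mulnn.
rewrite -mulnA; apply: leq_trans (leq_card_bigcup_const
  (D := n ^ (2 * h) * (64 * ((w + 2) * S)) ^ e) _) _; last by rewrite leq_mul2r cs_card orbT.
move=> c; rewrite inE => /forallP cS.
apply: leq_trans (leq_card_bigcup_const (D := (64 * ((w + 2) * S)) ^ e) _) _; last first.
  by rewrite leq_mul2r Es_card orbT.
move=> E; rewrite inE => Eh; apply: leq_trans (card_graphs_with_edges_in _ _) _.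
apply: bin_leq_pow => //.
have : #|\bigcup_(p in E) pairs_between c p| <= h * ((2 * S) * (2 * S)).
  apply: leq_trans (leq_card_bigcup_const (D := (2 * S) * (2 * S)) _) _.
    by move=> p _; apply: card_pairs_between.
  by rewrite leq_mul2r Eh orbT.
have ne : n <= 2 * e by rewrite eE leq_pmulr.
(* At most [h * 4 S ^ 2] pairs are available; as [m * S <= n <= 2 e], the ratio to [e] needed in
   [bin_leq_pow] is at most [64 (w + 2) S]. *)
move=> X_le; apply: (@leq_trans (m * S * (32 * ((w + 2) * S)))).
  apply: leq_trans (leq_mul (leqnn 4) X_le) _.
  rewrite (_ : 4 * _ = m * S * (16 * ((2 * w + 3) * S))); last by rewrite /h; lia.
  rewrite leq_mul2l; apply/orP; right.
  rewrite (_ : 32 * _ = 16 * ((2 * w + 4) * S)); last by lia.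
  by rewrite leq_mul2l leq_mul2r leq_add2l orbT.
apply: leq_trans (leq_mul (leq_trans mS ne) (leqnn _)) _.
by rewrite [2 * e]mulnC -mulnA (mulnA 2 32).
Qed.

(* A 2-regular graph of twin-width 0 is determined by a choice [c] of a
   representative in each component, together with the edges inside the fibres
   of [c]; these have at most four elements. *)
Lemma card_tww0 : 2 < #|T| ->
  #|[set G : sgraph T | regular 2 G & tww G <= 0]| <=
  2 ^ #|T| * #|T| ^ (#|T| - #|T| %/ 4) * 2 ^ (4 * #|T|).
Proof.
move=> T2; set n := #|T| in T2 *; have n0 : 0 < n by lia.
(* [I] stands for the set of representatives. Fibres have at most [4 = 2 * d] elements, so [I]
   contains a quarter of the vertices, and [c] is free only outside [I]. *)
pose ident (I : {set T}) := [set c : {ffun T -> T} |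
  [forall x in I, c x == x] & [forall j, #|[set a | c a == j]| <= 4]].
pose diag (c : {ffun T -> T}) := \bigcup_(a in [set: T]) [set [set a; b] | b in [set b | c b == c a]].
pose Is := [set I : {set T} | n <= 4 * #|I|].
apply: (@leq_trans #|\bigcup_(I in Is) \bigcup_(c in ident I)
    [set G : sgraph T | edges G \subset diag c]|).
  apply: subset_leq_card; apply/subsetP => G; rewrite inE => /andP[Greg Gw].
  have csym : connect_sym (adj G) by apply: sym_connect_sym; apply: adj_sym.
  have G0 : has_contraction_sequence G 0.
    by have := tww_has G n0; rewrite leqn0 in Gw; rewrite (eqP Gw).
  pose c := [ffun v => fingraph.root (adj G) v].
  have cE a b : (c a == c b) = connect (adj G) a b by rewrite !ffunE fingraph.root_connect.
  have small j : #|[set a | c a == j]| <= 4.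
    have [a /eqP ca|H] := pickP [pred a | c a == j]; last first.
      rewrite (_ : [set a | _] = set0) ?cards0 //; apply/setP => a; rewrite !inE.
      exact: H.
    have [A aA [A4 Acl]] := closed_set_of_tww0 a Greg isT T2 G0.
    apply: leq_trans A4; apply: subset_leq_card; apply/subsetP => b; rewrite inE -ca cE csym.
    have acl : closed (adj G) (mem A).
      apply: intro_closed; first exact: csym.
      by move=> x y xy xA; apply: Acl xA xy.
    by move/(closed_connect acl) => /= <-.
  apply/bigcupP; exists [set c x | x : T].
    rewrite inE mulnC; apply: leq_trans (leq_card_bigcup_const (F := fun j => [set a | c a == j]) _).
      rewrite /n -cardsT; apply: subset_leq_card; apply/subsetP => x _.
      by apply/bigcupP; exists (c x); [apply: imset_f|rewrite inE].
    by move=> j _; apply: small.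
  apply/bigcupP; exists c.
    rewrite inE; apply/andP; split; last by apply/forallP.
    by apply/forall_inP => x /imsetP[y _ ->]; rewrite !ffunE (fingraph.root_root csym).
  rewrite inE; apply/subsetP => e eG.
  have /cards2P[x [y [_ eE]]] := forall_inP (edgesP G) _ eG.
  apply/bigcupP; exists x; rewrite ?inE //; apply/imsetP; exists y => //.
  by rewrite inE cE csym connect1 // /adj -eE.
rewrite -mulnA; apply: leq_trans (leq_card_bigcup_const (D := n ^ (n - n %/ 4) * 2 ^ (4 * n)) _) _; last first.
  rewrite leq_mul2r; apply/orP; right; apply: leq_trans (max_card _) _.
  by rewrite -cardsT -powersetT card_powerset cardsT.
move=> I; rewrite inE => nI.
have ident_card : #|ident I| <= n ^ (n - n %/ 4).
  have [x0 _] := card_gt0P n0.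
  pose res (c : {ffun T -> T}) := [ffun x => if x \in I then x0 else c x].
  rewrite -(card_in_imset (f := res)).
    apply: (@leq_trans #|pffun_on x0 (mem (~: I)) (@predT T)|).
      apply: subset_leq_card; apply/subsetP => _ /imsetP[c _ ->]; apply/pffun_onP.
      by split=> //; apply/subsetP => x; rewrite !inE ffunE; case: ifP => //; rewrite eqxx.
    rewrite card_pffun_on leq_pexp2l // cardsCs setCK leq_sub2l //.
    by apply: leq_trans (leq_div2r 4 nI) _; rewrite mulKn.
  move=> c1 c2; rewrite !inE => /andP[/forall_inP c1I _] /andP[/forall_inP c2I _] /ffunP E.
  apply/ffunP => x; have := E x; rewrite !ffunE; case: ifP => // xI _.
  by rewrite (eqP (c1I x xI)) (eqP (c2I x xI)).
apply: leq_trans (leq_card_bigcup_const (D := 2 ^ (4 * n)) _) _; last first.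
  by rewrite leq_mul2r ident_card orbT.
move=> c; rewrite inE => /andP[_ /forallP c4].
apply: leq_trans (card_graphs_with_subset_edges _) _; rewrite leq_exp2l //.
rewrite mulnC /n -cardsT; apply: leq_card_bigcup_const => a _.
exact: leq_trans (leq_imset_card _ _) (c4 _).
Qed.

End Counting.

(** * Counting regular graphs *)

Section GraphOfRelation.
Variable T : finType.

Lemma pairset_sgraphP (e : rel T) : [forall E in pairset id e, #|E| == 2].
Proof.
apply/forall_inP => E EP.
by have /andP[] := forall_inP (pairset_valid id e) _ EP.
Qed.

Definition graph_of (e : rel T) : sgraph T := SGraph (pairset_sgraphP e).

Lemma adj_graph_of (e : rel T) : symmetric e -> irreflexive e ->
  forall x y, adj (graph_of e) x y = e x y.
Proof.
move=> esym eirr x y; rewrite /adj mem_pairset //.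
have [->|xy] := eqVneq x y; first by rewrite eirr.
have p z : z \in parts id by apply/partsP; exists z.
by rewrite !p.
Qed.

Lemma regular_graph_of d (e : rel T) : symmetric e -> irreflexive e ->
  (forall x, #|[set y | e x y]| = d) -> regular d (graph_of e).
Proof.
move=> esym eirr ed; apply/forallP => x; rewrite degreeE -(ed x); apply/eqP.
by apply: eq_card => y; rewrite !inE adj_graph_of.
Qed.

End GraphOfRelation.

Lemma card_ord_interval N a b : b <= N -> #|[set x : 'I_N | a <= x < b]| = b - a.
Proof.
move=> bN; rewrite cardE -(size_map val) -(size_iota a (b - a)).
apply/perm_size/uniq_perm; rewrite ?iota_uniq ?(map_inj_uniq val_inj) ?enum_uniq //.
move=> i; rewrite mem_iota; apply/mapP/idP => [[x]|H].
  by rewrite mem_enum inE => H ->; move: H; rewrite /=; lia.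
have iN : i < N by lia.
by exists (Ordinal iN) => //; rewrite mem_enum inE /=; lia.
Qed.

Lemma exists_regular_relation N d : d < N -> ~~ odd (d * N) ->
  exists e : rel 'I_N, [/\ symmetric e, irreflexive e &
    forall x, #|[set y | e x y]| = d].
Proof.
(* The circulant graph with connection set [S] below. *)
case: N => // n dN odN.
have [h dE] : exists h, d = odd d + h.*2 by exists d./2; rewrite odd_double_half.
(* [B] consists of the negatives of [A]; [C] is the single involution [n.+1./2] when [d] is odd, in
   which case [n.+1] is even, and empty otherwise. *)
pose A := [set x : 'I_n.+1 | 1 <= x < h.+1].
pose B := [set x : 'I_n.+1 | n.+1 - h <= x < n.+1].
pose C := [set x : 'I_n.+1 | n.+1./2 <= x < odd d + n.+1./2].
have NE : odd d -> n.+1 = (n.+1./2).*2.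
  by move=> od; rewrite even_halfK //; move: odN; rewrite oddM od.
pose S := A :|: B :|: C.
have oppE (x : 'I_n.+1) : 0 < x -> nat_of_ord (- x)%R = n.+1 - x.
  by move=> x0; rewrite /= modn_small // ltn_subrL x0.
have S0 (x : 'I_n.+1) : x \in S -> 0 < x by rewrite !inE; case: (odd d) NE dE => /= [/(_ isT)|_]; lia.
have Sopp x : x \in S -> (- x)%R \in S.
  move=> xS; have x0 := S0 x xS; move: xS; rewrite !inE oppE //.
  have := ltn_ord x; case: (odd d) NE dE => /= [/(_ isT)|_]; lia.
have cardS : #|S| = d.
  have cA : #|A| = h by rewrite card_ord_interval; lia.
  have cB : #|B| = h by rewrite card_ord_interval; lia.
  have cC : #|C| = odd d.
    by rewrite card_ord_interval ?addnK //; case: (odd d) NE dE => /= [/(_ isT)|_]; lia.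
  have AB : A :&: B = set0.
    by apply/setP => x; rewrite !inE; apply/negP; lia.
  have ABC : (A :|: B) :&: C = set0.
    apply/setP => x; rewrite !inE; apply/negP; have := ltn_ord x.
    by case: (odd d) NE dE => /= [/(_ isT)|_]; lia.
  by rewrite /S cardsU ABC cards0 subn0 cardsU AB cards0 subn0 cA cB cC addnn addnC -dE.
exists (fun x y : 'I_n.+1 => (y - x)%R \in S); split.
- have H x y : (y - x)%R \in S -> (x - y)%R \in S by move/Sopp; rewrite opprB.
  by move=> x y; apply/idP/idP; apply: H.
- by move=> x; rewrite subrr; apply/negP => /S0.
- move=> x; rewrite -cardS -(card_imset (mem S) (@addIr _ x)); apply: eq_card => y.
  rewrite inE; apply/idP/imsetP => [H|[s sS ->]]; last by rewrite addrK.
  by exists (y - x)%R; rewrite ?subrK.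
Qed.

Section Lifts.
Variables (d q N : nat) (F : rel 'I_N).
Hypotheses (F_sym : symmetric F) (F_irr : irreflexive F).
Hypothesis F_deg : forall x, #|[set y | F x y]| = d.

Notation V := (('I_d * 'I_q + 'I_d * 'I_q) + 'I_N)%type.
Notation lifts := {ffun 'I_d * 'I_d -> {perm 'I_q}}.

(* A lift of the complete bipartite graph [K_{d,d}], and [F] on the rest. *)
Definition lift_rel (s : lifts) : rel V := fun u v =>
  match u, v with
  | inl (inl a), inl (inr b) => s (a.1, b.1) a.2 == b.2
  | inl (inr b), inl (inl a) => s (a.1, b.1) a.2 == b.2
  | inr x, inr y => F x y
  | _, _ => false
  end.

Lemma lift_rel_sym s : symmetric (lift_rel s).
Proof. by case=> [[a|a]|x] [[b|b]|y] //=. Qed.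

Lemma lift_rel_irr s : irreflexive (lift_rel s).
Proof. by case=> [[a|a]|x] //=. Qed.

Lemma lift_rel_deg s u : #|[set v | lift_rel s u v]| = d.
Proof.
case: u => [[[i x]|[j y]]|x].
- rewrite -[RHS]card_ord -[RHS]cardsT.
  rewrite -(card_imset _ (f := fun j => inl (inr (j, s (i, j) x)) : V)); last by move=> j j' [].
  apply: eq_card => -[[[j y]|[j y]]|z]; rewrite inE /=; try by apply/esym/imsetP => -[].
  apply/eqP/imsetP => [<-|[j' _ [-> ->]] //]; by exists j.
- rewrite -[RHS]card_ord -[RHS]cardsT.
  rewrite -(card_imset _ (f := fun i => inl (inl (i, (s (i, j))^-1%g y)) : V)); last by move=> i i' [].
  apply: eq_card => -[[[i x]|[i x]]|z]; rewrite inE /=; try by apply/esym/imsetP => -[].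
  apply/eqP/imsetP => [<-|[i' _ [-> ->]]]; last by rewrite permKV.
  by exists i; rewrite ?permK.
- apply: etrans (F_deg x).
  rewrite -[RHS](card_imset _ (f := fun z => inr z : V)); last by move=> z z' [].
  apply: eq_card => -[[a|a]|z]; rewrite inE /=; try by apply/esym/imsetP => -[].
  by apply/idP/imsetP => [H|[z' + [->]]]; [exists z; rewrite ?inE|rewrite inE].
Qed.

(** Different lifts give different labelled graphs, as the edges between the two sides show every
    value of every permutation. *)
Lemma card_regular_ge n : n = 2 * (d * q) + N ->
  q`! ^ (d * d) <= #|[set G : sgraph 'I_n | regular d G]|.
Proof.
move=> nE; have VE : n = #|{: V}| by rewrite !card_sum card_prod !card_ord nE; lia.
pose b (x : 'I_n) : V := enum_val (cast_ord VE x).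
have b_inj : injective b by move=> x y /enum_val_inj /cast_ord_inj.
have b_surj v : exists x, b x = v.
  by exists (cast_ord (esym VE) (enum_rank v)); rewrite /b cast_ordKV enum_rankK.
pose graph s := graph_of (fun x y => lift_rel s (b x) (b y)).
have gsym s : symmetric (fun x y => lift_rel s (b x) (b y)).
  by move=> x y; apply: lift_rel_sym.
have girr s : irreflexive (fun x y => lift_rel s (b x) (b y)).
  by move=> x; apply: lift_rel_irr.
have -> : q`! ^ (d * d) = #|[set graph s | s : lifts]|.
  rewrite card_imset ?card_ffun ?card_prod ?card_ord; last first.
    move=> s s' E; apply/ffunP => -[i j]; apply/permP => x.
    have [u uE] := b_surj (inl (inl (i, x))).
    have [v vE] := b_surj (inl (inr (j, s (i, j) x))).
    have : adj (graph s) u v by rewrite adj_graph_of // uE vE /= eqxx.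
    by rewrite E adj_graph_of // uE vE /= => /eqP.
  by rewrite -card_Sn -cardsT.
apply: subset_leq_card; apply/subsetP => _ /imsetP[s _ ->]; rewrite inE.
apply: regular_graph_of => // x; apply: etrans (lift_rel_deg s (b x)).
rewrite -[LHS](card_imset _ b_inj); apply: eq_card => v; rewrite inE.
apply/imsetP/idP => [[y + ->]|H]; first by rewrite inE.
by have [y yE] := b_surj v; exists y; rewrite ?inE yE.
Qed.

End Lifts.

Lemma card_regular_graphs_ge d n : 0 < d -> 4 * d <= n -> ~~ odd (d * n) ->
  ((n %/ (2 * d)).-1)`! ^ (d * d) <= #|[set G : sgraph 'I_n | regular d G]|.
Proof.
(* One block of [2 d] vertices is left to the remainder, making [N] larger than [d]; as [2 d q] is
   even, [d * N] has the parity of [d * n]. *)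
move=> d0 dn odn; set q := (n %/ (2 * d)).-1; pose N := n %% (2 * d) + 2 * d.
have q1 : 0 < n %/ (2 * d) by rewrite divn_gt0; lia.
have nE : n = 2 * (d * q) + N.
  have := divn_eq n (2 * d); rewrite /N /q; move: (n %% _) q1; case: (n %/ _) => // p r _ /=.
  by move=> ->; rewrite mulSn; lia.
have [||e [esym eirr edeg]] := @exists_regular_relation N d.
- by rewrite /N; lia.
- have := odn; rewrite {1}nE !(oddM, oddD) /=; by case: (odd d).
exact: card_regular_ge esym eirr edeg _ nE.
Qed.

From mathcomp Require Import all_classical all_reals all_analysis.
From mathcomp Require Import zify ring lra.

Import Order.TTheory GRing.Theory Num.Theory.
Import numFieldNormedType.Exports.

Local Open Scope classical_set_scope.
Local Open Scope ring_scope.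

(** * Asymptotics *)

Section Asymptotics.
Variable R : realType.

Lemma powR_exp (a x : R) : 0 < a -> a `^ x = expR (x * ln a).
Proof. by move=> a0; rewrite /powR gt_eqF. Qed.

Lemma near_ln_ge (c : R) : \forall n \near \oo, c <= ln (n%:R : R).
Proof.
have H := nbhs_infty_ger (expR c); near=> n.
rewrite -[c]expRK ler_ln ?posrE ?expR_gt0 //; first by near: n.
apply: lt_le_trans (expR_gt0 c) _; near: n; exact: H.
Unshelve. all: by end_near. Qed.

Lemma tww_upper (d : nat) (hd : (2 <= d)%N) (delta : R) : 0 < delta ->
  exists n0 : nat, forall n : nat, (n0 <= n)%N ->
    forall (T : finType) (G : sgraph T), #|T| = n -> regular d G ->
      (tww G)%:R <= n%:R `^ ((d%:R - 2) / (2 * d%:R - 2) + delta).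
Proof.
case: d hd => // D D0 delta0; rewrite ltnS in D0.
(* The exponent [W / (M + W)] exceeds the limit by [1 / (2 (k + 1) D)], so [k > 1 / delta] keeps the
   error below [delta / 2]. *)
pose k := (Num.truncn delta^-1).+1.
have kd : delta^-1 < k%:R by apply: truncnS_gt.
have kd1 : 1 <= delta * k%:R.
  by rewrite -ler_pdivrMl // mulr1 ltW.
set W := fresh_weight D k; set M := total_weight D k.
set K := (8 * M * D.+1 + (D.+2 ^ (k + k).+1).+1 * 2 ^ ((D.+2 ^ (k + k).+1).+1 * M) *
  ((D.+2 ^ (k + k).+1).+1 * 2 ^ ((D.+2 ^ (k + k).+1).+1 * M)))%N.
have MW : (M + W = 2 * k.+1 * D ^ k)%N by apply: total_fresh_weight.
have MW0 : (0 < M + W)%N by rewrite MW !muln_gt0 expn_gt0 D0.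
set om := _ / _.
have omE : W%:R / (M + W)%:R <= om + delta / 2.
  rewrite MW /W /fresh_weight /om.
  have [E DE] : exists E, D = E.+1 by exists D.-1; rewrite prednK.
  have P0 : 0 < (D ^ k.-1)%:R :> R by rewrite ltr0n expn_gt0 D0.
  have -> : (D ^ k = D * D ^ k.-1)%N by rewrite -expnS.
  rewrite DE in P0 *; move: P0; set P := (_ ^ _)%N => P0 /=.
  rewrite -(natr1 E.+1) -(natr1 E) !(natrD, natrM) -(natr1 k) -(natr1 E).
  set x : R := E%:R; set y : R := k%:R in kd1 *; set p : R := P%:R in P0 *.
  have x0 : 0 <= x by apply: ler0n.
  have y0 : 0 <= y by apply: ler0n.
  have -> : ((x + 1) * p + y * (x * p)) / (2 * (y + 1) * ((x + 1) * p)) =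
      (x + 1 + 1 - 2) / (2 * (x + 1 + 1) - 2) + (2 * (y + 1) * (x + 1))^-1.
    by field; rewrite ?gt_eqF //=; nra.
  have xy : 0 < 2 * (y + 1) * (x + 1) by rewrite !mulr_gt0 //; lra.
  rewrite lerD2l -div1r ler_pdivrMr //; have := mulr_ge0 (ltW delta0) x0; nra.
have K0 : 0 < (K * 2 ^ W)%:R :> R.
  rewrite ltr0n muln_gt0 expn_gt0 andbT addn_gt0 !muln_gt0 /=.
  by rewrite total_weight_gt0.
(* From here on [K * 2 ^ W <= n ^ (delta / 2)]; the factor [2 ^ W] pays for rounding the alphabet
   size [rho] up to an integer. *)
exists (Num.truncn (expR (ln ((K * 2 ^ W)%:R) / (delta / 2) : R))).+1.
move=> n n0 T G Tn Greg.
have nr : expR (ln ((K * 2 ^ W)%:R) / (delta / 2)) <= n%:R :> R.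
  apply: le_trans (ltW (truncnS_gt _)) _; by rewrite ler_nat.
have n1 : 1 <= n%:R :> R by rewrite ler1n; apply: leq_ltn_trans n0.
have ngt0 : 0 < n%:R :> R by apply: lt_le_trans n1.
pose rho : R := n%:R `^ (M + W)%:R^-1.
have rho1 : 1 <= rho.
  by rewrite /rho powR_exp // -[leLHS]expR0 ler_expR mulr_ge0 ?invr_ge0 ?ler0n ?ln_ge0.
pose r := (Num.truncn rho).+1.
have rho_r : rho <= r%:R by apply/ltW/truncnS_gt.
have r_rho : r%:R <= 2 * rho.
  rewrite /r -natr1 mulr_natl mulr2n lerD // truncn_le.
  by apply: le_trans rho1.
have Tr : (#|T| <= r ^ (M + W))%N.
  rewrite Tn -(ler_nat R) natrX.
  have -> : n%:R = rho ^+ (M + W) :> R.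
    by rewrite -powR_mulrn ?powR_ge0 // -powRrM mulVf ?powRr1 // pnatr_eq0 -lt0n.
  by rewrite lerXn2r ?nnegrE ?powR_ge0 ?ler0n.
have T0 : (0 < #|T|)%N by rewrite Tn -(ler_nat R).
have := @tww_leq_fresh_weight D k D0 r T G (ltn0Sn _) T0 Greg Tr.
rewrite -/K -/W -(ler_nat R) => /le_trans; apply.
rewrite natrM natrX.
apply: (@le_trans _ _ (K%:R * (2 * rho) ^+ W)).
  by rewrite ler_wpM2l // lerXn2r ?nnegrE ?mulr_ge0 ?powR_ge0.
have -> : K%:R * (2 * rho) ^+ W = (K * 2 ^ W)%:R * expR (W%:R / (M + W)%:R * ln n%:R).
  rewrite exprMn natrM natrX mulrA; congr (_ * _).
  by rewrite -powR_mulrn ?powR_ge0 // -powRrM [_^-1 * _]mulrC powR_exp.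
rewrite powR_exp // -[in X in X <= _](lnK (x := (K * 2 ^ W)%:R)) ?posrE // -expRD ler_expR.
have ln0 : 0 <= ln (n%:R : R) by apply: ln_ge0.
have : ln ((K * 2 ^ W)%:R) <= delta / 2 * ln (n%:R : R).
  rewrite mulrC -ler_pdivrMr; last by rewrite divr_gt0.
  by rewrite -[X in X <= _]expRK ler_ln ?posrE ?expR_gt0.
move: omE; set q := _ / _; nra.
Qed.

End Asymptotics.

Section Asymptotics.
Variable R : realType.

Lemma natX_le_expR (m k : nat) (x : R) : m%:R <= expR x -> (m ^ k)%:R <= expR (k%:R * x).
Proof. by move=> mx; rewrite natrX expRM_natl lerXn2r ?nnegrE ?expR_ge0. Qed.

Lemma expR_le_natX (m k : nat) (x : R) : expR x <= m%:R -> expR (k%:R * x) <= (m ^ k)%:R.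
Proof. by move=> mx; rewrite natrX expRM_natl lerXn2r ?nnegrE ?expR_ge0. Qed.

Lemma expR_ln_nat (n : nat) : (0 < n)%N -> expR (ln (n%:R : R)) = n%:R.
Proof. by move=> n0; rewrite lnK // posrE ltr0n. Qed.

Lemma ln_nat_ge0 (n : nat) : 0 <= ln (n%:R : R).
Proof. by case: n => [|n]; [rewrite ln0|rewrite ln_ge0 ?ler1n]. Qed.

Lemma card_small_tww_expR (d n w S e : nat) (omega delta : R) :
  (0 < d)%N -> (1 < S)%N -> (d < S)%N -> (S <= n)%N -> (2 * e = n * d)%N ->
  let L := ln (n%:R : R) in 0 <= omega - delta ->
  w%:R <= expR ((omega - delta) * L) -> expR (omega * L) <= S%:R ->
  S%:R <= 2 * expR (omega * L) ->
  #|[set G : sgraph 'I_n | regular d G & (tww G <= w)%N]%SET|%:R <=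
  expR (n%:R * ((1 - omega) * L) + 10 * n%:R * expR (- (delta * L)) * L +
    d%:R / 2 * n%:R * (ln 384 + (2 * omega - delta) * L)).
Proof.
move=> d0 S1 Sd Sn eE L od wL SL LS.
have n0 : (0 < n)%N by apply: leq_trans Sn; apply: ltnW.
have L0 : 0 <= L by apply: ln_nat_ge0.
have ELn : expR L = n%:R by apply: expR_ln_nat.
have := @card_small_tww 'I_n d w S e; rewrite card_ord => /(_ d0 S1 Sd Sn eE).
rewrite -(ler_nat R) => /le_trans; apply; rewrite !natrM !expRD.
set m := (n %/ S)%N.
have mL : m%:R <= expR ((1 - omega) * L).
  rewrite mulrBl mul1r expRD expRN ELn ler_pdivlMr ?expR_gt0 //.
  apply: (@le_trans _ _ (m * S)%:R); last by rewrite ler_nat leq_trunc_div.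
  by rewrite natrM ler_wpM2l.
have w1 : 1 <= expR ((omega - delta) * L) by rewrite -[leLHS]expR0 ler_expR mulr_ge0.
apply: ler_pM; rewrite ?mulr_ge0 ?ler0n //.
  apply: ler_pM; rewrite ?ler0n //; first exact: natX_le_expR.
  have nL : n%:R <= expR L by rewrite ELn.
  apply: le_trans (natX_le_expR (2 * (m * (2 * w + 3)))%N nL) _.
  rewrite ler_expR ler_wpM2r // !natrM natrD natrM.
  (* [2 w + 3] is at most five times [n ^ (omega - delta)], and the number of chunks at most
     [n ^ (1 - omega)]. *)
  have -> : 10 * n%:R * expR (- (delta * L)) =
      2 * (expR ((1 - omega) * L) * (5 * expR ((omega - delta) * L))).
    have E : expR L * expR (- (delta * L)) =
        expR ((1 - omega) * L) * expR ((omega - delta) * L).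
      by rewrite -!expRD; congr expR; ring.
    by rewrite -ELn -[10 * _ * _]mulrA E; ring.
  rewrite ler_pM2l // ler_pM ?ler0n ?addr_ge0 ?mulr_ge0 ?ler0n //; lra.
have -> : d%:R / 2 * n%:R = e%:R :> R.
  have : (2 * e)%:R = (n * d)%:R :> R by rewrite eE.
  rewrite !natrM; lra.
apply: natX_le_expR; rewrite expRD lnK ?posrE ?ltr0n //.
rewrite (natrM R 64) (natrM R (w + 2)) (natrD R w).
(* [384 = 64 * 3 * 2], from [w + 2 <= 3 n ^ (omega - delta)] and [S <= 2 n ^ omega]. *)
have -> : (2 * omega - delta) * L = (omega - delta) * L + omega * L by ring.
rewrite expRD; apply: (@le_trans _ _ (64 * ((3 * expR ((omega - delta) * L)) * (2 * expR (omega * L))))).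
  rewrite ler_pM2l // ler_pM ?addr_ge0 ?ler0n //; lra.
by rewrite le_eqVlt; apply/orP; left; apply/eqP; ring.
Qed.

Lemma card_regular_expR (d n : nat) : (0 < d)%N -> (8 * d <= n)%N -> ~~ odd (d * n) ->
  let L := ln (n%:R : R) in ln (16 * d%:R) <= L ->
  expR ((d%:R / 2 * n%:R - 2 * d%:R ^+ 2) * (L - ln (16 * d%:R))) <=
  (#|[set G : sgraph 'I_n | regular d G]%SET|%:R : R).
Proof.
move=> d0 dn odn L Ld; have n0 : (0 < n)%N by apply: leq_trans dn; rewrite muln_gt0.
have dr : 0 < d%:R :> R by rewrite ltr0n.
have dn4 : (4 * d <= n)%N by apply: leq_trans dn; rewrite leq_mul2r orbT.
have := card_regular_graphs_ge d0 dn4 odn; rewrite -(ler_nat R); apply: le_trans.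
have d20 : (0 < 2 * d)%N by rewrite muln_gt0.
have : (n < (n %/ (2 * d)).+1 * (2 * d))%N by apply: ltn_ceil.
have : (4 <= n %/ (2 * d))%N by rewrite leq_divRL // mulnA.
case: (n %/ (2 * d))%N => // q q3 nq /=.
(* Here [q] is [n %/ (2 * d)] minus one, so [n <= 2 d (q + 2)], and [q >= 3] gives
   [n / (16 d) <= q / 4]. The [q] factors of [q!] then contribute [(q / 4) ^ q]. *)
have q4 : expR (L - ln (16 * d%:R)) <= q%:R / 4.
  rewrite expRD expRN expR_ln_nat // lnK ?posrE ?mulr_gt0 //.
  rewrite ler_pdivrMr ?mulr_gt0 //.
  have : n%:R <= (q.+2 * (2 * d))%:R :> R by rewrite ler_nat ltnW.
  have : 3 <= q%:R :> R by rewrite ler_nat.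
  rewrite -(addn2 q) !natrM natrD; nra.
have qf : expR (q%:R * (L - ln (16 * d%:R))) <= q`!%:R.
  rewrite expRM_natl; apply: (@le_trans _ _ ((q%:R / 4) ^+ q)).
    by rewrite lerXn2r ?nnegrE ?expR_ge0 ?divr_ge0.
  rewrite exprMn exprVn ler_pdivrMr ?exprn_gt0 // -natrX -natrX -natrM ler_nat mulnC.
  exact: exp_leq_fact.
apply: le_trans (expR_le_natX (d * d) qf); rewrite ler_expR mulrA ler_wpM2r ?subr_ge0 //.
have : n%:R <= (q.+2 * (2 * d))%:R :> R by rewrite ler_nat ltnW.
rewrite -(addn2 q) !natrM natrD; nra.
Qed.

Lemma card_tww0_expR (n : nat) : (2 < n)%N ->
  #|[set G : sgraph 'I_n | regular 2 G & (tww G <= 0)%N]%SET|%:R <=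
  expR (5 * n%:R * ln 2 + (3 / 4 * n%:R + 1) * ln (n%:R : R)).
Proof.
move=> n2; set L := ln n%:R; have n0 : (0 < n)%N by apply: leq_trans n2.
have L0 : 0 <= L by apply: ln_nat_ge0.
have := @card_tww0 'I_n; rewrite card_ord => /(_ n2).
rewrite -(ler_nat R) => /le_trans; apply; rewrite !natrM.
have two : 2%:R <= expR (ln 2) :> R by rewrite lnK ?posrE.
have -> : 5 * n%:R * ln 2 + (3 / 4 * n%:R + 1) * L =
  n%:R * ln 2 + (3 / 4 * n%:R + 1) * L + (4 * n%:R) * ln 2 by ring.
rewrite !expRD; apply: ler_pM; rewrite ?mulr_ge0 ?ler0n //.
  apply: ler_pM; rewrite ?ler0n //; first exact: natX_le_expR.
  have nL : n%:R <= expR L by rewrite expR_ln_nat.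
  apply: le_trans (natX_le_expR (n - n %/ 4)%N nL) _.
  rewrite ler_expR ler_wpM2r // natrB ?leq_div //.
  have : (n < (n %/ 4).+1 * 4)%N by apply: ltn_ceil.
  rewrite -(ltr_nat R) natrM -natr1; lra.
by rewrite -natrM; apply: natX_le_expR.
Qed.

End Asymptotics.

(** * Comparison of the two counts *)

Section LowerTail.
Variable R : realType.

(** By the choice of [om] the leading terms on both sides are [d / 2 * n * L] ([H6]). The saving
    [d / 2 * n * L * del] is at least [n * L * del], and each of the three groups of error terms
    costs at most a quarter of that. The final [+ n] becomes the factor [expR (- n)]. *)
Lemma exponent_compare (d n L om del C1 C2 eps : R) :
  2 <= d -> 0 < del -> 0 <= n -> 0 <= L -> 0 <= C2 -> (2 * d - 2) * om = d - 2 ->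
  eps <= del / 40 -> (d / 2 * (C1 + C2) + 1) * (4 / del) <= L -> d ^+ 2 * 8 / del <= n ->
  n * ((1 - om) * L) + 10 * n * eps * L + d / 2 * n * (C1 + (2 * om - del) * L) + n <=
  (d / 2 * n - 2 * d ^+ 2) * (L - C2).
Proof.
move=> d2 del0 n0 L0 C20 omE epsE LE nE.
have nL : 0 <= n * L by apply: mulr_ge0.
have nLd : 0 <= n * L * del by rewrite mulr_ge0 // ltW.
have H1 : 10 * n * eps * L <= n * L * del / 4.
  have := ler_wpM2l nL epsE; lra.
have H2 : (d / 2 * (C1 + C2) + 1) * n <= n * L * del / 4.
  have : (d / 2 * (C1 + C2) + 1) * 4 <= L * del.
    by move: LE; rewrite mulrA ler_pdivrMr.
  move/(ler_wpM2l n0); lra.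
have H3 : 2 * d ^+ 2 * L <= n * L * del / 4.
  have : d ^+ 2 * 8 <= n * del by move: nE; rewrite ler_pdivrMr.
  move/(ler_wpM2l L0); lra.
have H4 : n * L * del <= d / 2 * (n * L * del).
  by rewrite ler_peMl //; lra.
have H5 : 0 <= d ^+ 2 * C2 by rewrite mulr_ge0 ?sqr_ge0.
have H6 : n * ((1 - om) * L) + d / 2 * n * (2 * om * L) = d / 2 * n * L.
  have -> : n * ((1 - om) * L) + d / 2 * n * (2 * om * L) =
    n * L * (1 + ((2 * d - 2) * om) / 2) by field.
  by rewrite omE; field.
lra.
Qed.

Lemma near_small_tww (d : nat) (hd : (2 < d)%N) (delta : R) : 0 < delta ->
  let om := (d%:R - 2) / (2 * d%:R - 2) in
  \forall n \near \oo, ~~ odd (d * n) ->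
  #|[set G : sgraph 'I_n | regular d G & ((tww G)%:R < n%:R `^ (om - delta))]%SET|%:R <=
  expR (- n%:R) * (#|[set G : sgraph 'I_n | regular d G]%SET|%:R : R).
Proof.
move=> delta0 om; have d3 : 3 <= d%:R :> R by rewrite ler_nat.
have omE : (2 * d%:R - 2) * om = d%:R - 2.
  by rewrite /om mulrC divfK // gt_eqF //; lra.
have om0 : 0 < om by rewrite /om divr_gt0 //; lra.
have om2 : om <= 1 / 2 by nra.
(* Capping at [om] keeps the exponent [om - del] nonnegative. *)
pose del := Num.min delta om.
have del0 : 0 < del by rewrite /del lt_min delta0.
have del_om : del <= om by rewrite /del ge_min lexx orbT.
have del_delta : del <= delta by rewrite /del ge_min lexx.
have C20 : 0 <= ln (16 * d%:R) :> R by rewrite ln_ge0 //; lra.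
have A1 := near_ln_ge (ln (16 * d%:R) : R).
have A2 := near_ln_ge ((d%:R / 2 * (ln 384 + ln (16 * d%:R)) + 1) * (4 / del) : R).
(* [A3] makes [n ^ (- del)] at most [del / 40]; [A4] makes [n ^ om] at least [d], so that [d < S];
   [A5] gives [2 n ^ om <= n], as [om <= 1 / 2], so that [S <= n]. *)
have A3 := near_ln_ge (- ln (del / 40) / del : R).
have A4 := near_ln_ge (ln d%:R / om : R).
have A5 := near_ln_ge (2 * ln 2 : R).
have A6 := nbhs_infty_ger (d%:R ^+ 2 * 8 / del : R).
near=> n => odn.
set L : R := ln n%:R.
have L1 : ln (16 * d%:R) <= L by rewrite /L; near: n.
have L2 : (d%:R / 2 * (ln 384 + ln (16 * d%:R)) + 1) * (4 / del) <= L by rewrite /L; near: n.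
have L3 : - ln (del / 40) / del <= L by rewrite /L; near: n.
have L4 : ln d%:R / om <= L by rewrite /L; near: n.
have L5 : 2 * ln 2 <= L by rewrite /L; near: n.
have n6 : d%:R ^+ 2 * 8 / del <= n%:R :> R by near: n.
have n8 : (8 * d <= n)%N by near: n; apply: nbhs_infty_ge.
have n0 : (0 < n)%N by apply: leq_trans n8; rewrite muln_gt0 /= ltnW // ltnW.
have L0 : 0 <= L by apply: ln_nat_ge0.
have ELn : expR L = n%:R by apply: expR_ln_nat.
pose w := Num.truncn (expR ((om - del) * L)).
pose S := (Num.truncn (expR (om * L))).+1.
have x1 : 1 <= expR (om * L) by rewrite -[leLHS]expR0 ler_expR mulr_ge0 // ltW.
have Sge : expR (om * L) <= S%:R by apply/ltW/truncnS_gt.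
have Sle : S%:R <= 2 * expR (om * L).
  by rewrite /S -natr1 mulr_natl mulr2n lerD // truncn_le expR_ge0.
have wle : w%:R <= expR ((om - del) * L) by rewrite truncn_le expR_ge0.
have dS : (d < S)%N.
  rewrite ltnS truncn_ge_nat ?expR_ge0 // -[leLHS]lnK ?posrE; last by lra.
  by rewrite ler_expR mulrC -ler_pdivrMr.
have S1 : (1 < S)%N by apply: leq_ltn_trans dS; apply: ltnW; apply: ltnW.
have Sn : (S <= n)%N.
  rewrite -(ler_nat R); apply: le_trans Sle _; rewrite -ELn -[X in X * _](lnK (x := 2)) ?posrE //.
  by rewrite -expRD ler_expR; nra.
have eE : (2 * (d * n)./2 = n * d)%N.
  by rewrite mul2n even_halfK // mulnC.
have d0 : (0 < d)%N by apply: leq_trans hd.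
have B1 := card_small_tww_expR d0 S1 dS Sn eE (_ : 0 <= om - del) wle Sge Sle.
rewrite subr_ge0 in B1; have {}B1 := B1 del_om.
have B2 := card_regular_expR d0 n8 odn L1.
apply: (@le_trans _ _ #|[set G : sgraph 'I_n | regular d G & (tww G <= w)%N]%SET|%:R).
  rewrite ler_nat; apply: subset_leq_card; apply/fintype.subsetP => G.
  rewrite !inE => /andP[-> /= Gw]; rewrite /w truncn_ge_nat ?expR_ge0 //.
  apply: le_trans (ltW Gw) _; rewrite powR_exp ?ltr0n // ler_expR ler_wpM2r //.
  by rewrite lerD2l lerN2.
apply: le_trans B1 _; apply: le_trans (ler_wpM2l (expR_ge0 _) B2).
rewrite -expRD ler_expR -lerBlDl opprK -/L.
apply: exponent_compare => //; first by lra.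
rewrite -[leRHS]lnK ?posrE ?divr_gt0 // ler_expR.
by move: L3; rewrite ler_pdivrMr // mulrC; lra.
Unshelve. all: by end_near. Qed.

(** For [d = 2] the limit exponent is [0], and a width below [n ^ (- delta) <= 1] is [0]. There are
    about [n ^ (3 n / 4)] such graphs at most, against about [n ^ n] regular ones. *)
Lemma near_small_tww2 (delta : R) : 0 < delta ->
  \forall n \near \oo, ~~ odd (2 * n) ->
  #|[set G : sgraph 'I_n | regular 2 G & ((tww G)%:R < n%:R `^ (- delta))]%SET|%:R <=
  expR (- n%:R) * (#|[set G : sgraph 'I_n | regular 2 G]%SET|%:R : R).
Proof.
move=> delta0.
have C20 : 0 <= ln (16 * 2%:R) :> R by rewrite ln_ge0 //; lra.
have A1 := near_ln_ge (ln (16 * 2%:R) : R).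
have A2 := near_ln_ge (8 * (5 * ln 2 + ln (16 * 2%:R) + 1) : R).
near=> n => odn.
set L : R := ln n%:R.
have L1 : ln (16 * 2%:R) <= L by rewrite /L; near: n.
have L2 : 8 * (5 * ln 2 + ln (16 * 2%:R) + 1) <= L by rewrite /L; near: n.
have n8 : (72 <= n)%N by near: n; apply: nbhs_infty_ge.
have n16 : (8 * 2 <= n)%N by apply: leq_trans n8.
have n1 : 1 <= n%:R :> R by rewrite ler1n; apply: leq_trans n8.
have L0 : 0 <= L by apply: ln_nat_ge0.
have B1 := card_tww0_expR R (leq_trans (isT : (2 < 72)%N) n8).
have B2 := card_regular_expR (isT : (0 < 2)%N) n16 odn L1.
apply: (@le_trans _ _ #|[set G : sgraph 'I_n | regular 2 G & (tww G <= 0)%N]%SET|%:R).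
  rewrite ler_nat; apply: subset_leq_card; apply/fintype.subsetP => G.
  rewrite !inE => /andP[-> /= Gw]; rewrite -ltnS -(ltr_nat R); apply: lt_le_trans Gw _.
  by rewrite powR_exp ?(lt_le_trans ltr01 n1) // -[leRHS]expR0 ler_expR mulNr oppr_le0 mulr_ge0 // ltW.
apply: le_trans B1 _; apply: le_trans (ler_wpM2l (expR_ge0 _) B2).
rewrite -expRD ler_expR -/L.
have n72 : 72 <= n%:R :> R by rewrite (ler_nat R 72).
have H := ler_wpM2l (le_trans ler01 n1) L2; have H' := ler_wpM2r L0 n72.
move: H H' L1 C20; set c := ln (16 * 2%:R); set c' := ln 2; lra.
Unshelve. all: by end_near. Qed.

Lemma near_regular_gt0 (d : nat) : (0 < d)%N ->
  \forall n \near \oo, ~~ odd (d * n) -> (0 < #|[set G : sgraph 'I_n | regular d G]%SET|)%N.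
Proof.
move=> d0; near=> n => odn; apply: leq_trans (card_regular_graphs_ge d0 _ odn).
  by rewrite expn_gt0 fact_gt0.
by near: n; apply: nbhs_infty_ge.
Unshelve. all: by end_near. Qed.

(** The complementary event has probability at most [expR (- n)], which is below [eps] once [n] is
    at least [- ln eps]. *)
Lemma tww_lower (d : nat) (hd : (2 <= d)%N) (delta : R) : 0 < delta ->
  uniform_pr R
    [set G : sgraph 'I_n | regular d G]%SET
    [set G : sgraph 'I_n |
      n%:R `^ ((d%:R - 2) / (2 * d%:R - 2) - delta) <= (tww G)%:R :> R]%SET
    @[n --> within [set n : nat | ~~ odd (d * n)] \oo] --> (1 : R).
Proof.
move=> delta0; set om := _ / _.
have bad : \forall n \near \oo, ~~ odd (d * n) ->
    #|[set G : sgraph 'I_n | regular d G & ((tww G)%:R < n%:R `^ (om - delta))]%SET|%:R <=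
    expR (- n%:R) * (#|[set G : sgraph 'I_n | regular d G]%SET|%:R : R).
  move: hd; rewrite leq_eqVlt => /orP[/eqP d2|d3]; last exact: near_small_tww.
  rewrite /om -d2 subrr mul0r sub0r; exact: near_small_tww2.
have pos := near_regular_gt0 (ltnW hd).
apply/cvgrPdist_le => eps eps0; rewrite near_withinE.
have far := nbhs_infty_ger (- ln eps).
near=> n => /= odn.
have pos_n : 0 < #|[set G : sgraph 'I_n | regular d G]%SET|%:R :> R.
  by rewrite ltr0n; move: odn; near: n.
have bad_n : #|[set G : sgraph 'I_n | regular d G & ((tww G)%:R < n%:R `^ (om - delta))]%SET|%:R <=
    expR (- n%:R) * (#|[set G : sgraph 'I_n | regular d G]%SET|%:R : R).
  by move: odn; near: n.
have far_n : - ln eps <= n%:R by near: n.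
rewrite /uniform_pr.
set Sn := [set G : sgraph 'I_n | regular d G]%SET in pos_n bad_n *.
set A := [set G : sgraph 'I_n | _]%SET.
set B := [set G : sgraph 'I_n | _]%SET in bad_n.
have SE : #|Sn|%:R = #|Sn :&: A|%:R + #|B|%:R :> R.
  rewrite -natrD -(cardsID A Sn); congr (_ + _)%:R; apply: eq_card => G.
  by rewrite !inE -ltNge andbC.
rewrite (_ : 1 - _ = #|B|%:R / #|Sn|%:R); last first.
  by rewrite -[X in X - _](divff (lt0r_neq0 pos_n)) -mulrBl SE addrC addKr.
rewrite ger0_norm ?divr_ge0 // ler_pdivrMr //; apply: le_trans bad_n _.
rewrite ler_pM2r // -[leRHS]lnK ?posrE // ler_expR; lra.
Unshelve. all: by end_near. Qed.

End LowerTail.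

Theorem theorem1p1 (R : realType) (d : nat) (hd : (2 <= d)%N) :
  (forall delta : R, 0 < delta ->
    exists n0 : nat, forall n : nat, (n0 <= n)%N ->
      forall (T : finType) (G : sgraph T), #|T| = n -> regular d G ->
        (tww G)%:R <= n%:R `^ ((d%:R - 2) / (2 * d%:R - 2) + delta)) /\
  (forall delta : R, 0 < delta ->
    uniform_pr R
      [set G : sgraph 'I_n | regular d G]%SET
      [set G : sgraph 'I_n |
        n%:R `^ ((d%:R - 2) / (2 * d%:R - 2) - delta) <= (tww G)%:R :> R]%SET
      @[n --> within [set n : nat | ~~ odd (d * n)] \oo] --> (1 : R)).
Proof.
split=> delta delta0; [exact: tww_upper|exact: tww_lower].
Qed.
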